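(* Let $n\in\mathbb N$ be fixed and let $\mathcal K_n=\{k_1,\dots,k_n\}\subset\mathcal K$ be a set of $n$ parameter values. Let $\boldsymbol G\in\mathbb R^{n\times n}$ be the Gramian with entries $G_{a,b}=\langle u(\cdot,k_b),u(\cdot,k_a)\rangle$, and assume that its smallest singular value satisfies $\sigma_{\min}(\boldsymbol G)>0$. Let $\mathcal P_n:H\to \mathrm{span}\{u(\cdot,k_1),\dots,u(\cdot,k_n)\}$ be the $H$-orthogonal projector and set $w(\cdot,k):=\mathcal P_n u(\cdot,k)\in H$. Let $\widehat u_j(\cdot,k)$ be the multifidelity approximation at level $j\ge 1$ built from $\mathcal K_n$, as defined in the context. Then there exists $\bar h>0$ such that for all coarse timesteps $h<\bar h$ (of the form $h=T/N$ admitted in the context), $$\max_{k\in\mathcal K}\ \max_{m=1,\dots,M}\ \max_{i\in[N_j]}\left|w^{(m)}(ih_j,k)-\widehat u_j^{(m)}(i,k)\right|\le C_1h^p+C_2h_j^p,$$ where $$C_1=C_1(T,L,p,U,n,\boldsymbol G)=C(T,L,p)\,\frac{U^3n^2}{\sigma_{\min}^2(\boldsymbol G)},\qquad C_2=C_2(T,L,p,U,n,\boldsymbol G)=C(T,L,p)\,\frac{U^2n}{\sigma_{\min}(\boldsymbol G)},$$ and $C(T,L,p)$ denotes constants depending only on $T$, $L$ and $p$; all dependence of $C_1$ and $C_2$ on $U$, $n$ and $\boldsymbol G$ is through the displayed factors.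
   Context: **ODE.** $\mathcal K\subset\mathbb R^d$ is compact, $T>0$, $M\ge1$. For each $k\in\mathcal K$, $u(\cdot,k):[0,T]\to\mathbb R^M$ solves $\frac{\partial u}{\partial t}(t,k)=f(t,u,k)$, $u(0,k)=u_0(k)$. Superscripts $(m)$, $m=1,\dots,M$, denote components. Standing assumptions: (1) The solution $u(\cdot,k)$ exists and is unique on $[0,T]$ for every $k\in\mathcal K$, and $f$ is smooth enough that, for an integer $p\ge2$, $U^{(s)}:=\max_{k\in\mathcal K}\max_{m}\sup_{t\in[0,T]}|\partial_t^s u^{(m)}(t,k)|<\infty$ for $0\le s\le p$. (2) For all $t\in[0,T]$ and $u\in\mathbb R^M$, $k\mapsto f(t,u,k)$ is continuous on $\mathcal K$, and $k\mapsto u_0(k)$ is continuous on $\mathcal K$. **Continuous space.** $H=L^2([0,T];\mathbb R^M)$ with $\langle u,v\rangle=\frac1{MT}\sum_{m=1}^M\int_0^Tu^{(m)}(t)v^{(m)}(t)\,dt$ and $\|u\|^2=\langle u,u\rangle$. Elements of $\mathrm{span}\{u(\cdot,k_q)\}$ are evaluated pointwise via their continuous representatives. **Time grids.** $N\in\mathbb N$, $h=T/N$, $r\ge2$ is a fixed integer, $h_j=h/r^{j-1}$, $N_j=Nr^{j-1}$ for $j\ge1$, so $h_1=h$. $[N_j]=\{0,1,\dots,N_j\}$. **Time integrator.** $u_j(i,k)\in\mathbb R^M$, $i\in[N_j]$, is the discrete solution at time $ih_j$ produced with timestep $h_j$ by a fixed time integration method, stable and convergent for all $k\in\mathcal K$,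 of global order $p$ (the same $p$ as in (1), and $p\le6$). Its global truncation error satisfies, for all $h_j$ small enough, $\max_m\max_{i\in[N_j]}|u^{(m)}(ih_j,k)-u_j^{(m)}(i,k)|\le C(T,L)h_j^p$ for all $k\in\mathcal K$, where $C(T,L)$ does not depend on $k$ and depends on $T$ and on bounds on derivatives of $f$; the symbol $L$ stands for these bounds on derivatives of $f$. **Quadrature weights.** Let $P=\max\{2\lfloor (p-1)/2\rfloor,1\}$ and assume $N$ is divisible by $P$. For each $j$, $w_{j,i}$, $i\in[N_j]$, are the (positive) weights of the composite closed $(P+1)$-point Newton–Cotes rule on $[0,T]$ with nodes $ih_j$ (apply the $(P+1)$-point closed Newton–Cotes rule on each of the $N_j/P$ consecutive subintervals of length $Ph_j$ and add), divided by $T$, so that $\sum_{i\in[N_j]}w_{j,i}=1$. **Discrete space.** $H_j$ is the space of functions $[N_j]\to\mathbb R^M$ with $\langle u,v\rangle_j=\frac1M\sum_{i\in[N_j]}w_{j,i}\,v(i)^Tu(i)$ and $\|u\|_j^2=\langle u,u\rangle_j$. Write $U_j=\max_{k\in\mathcal K}\|u_j(\cdot,k)\|_j$ and $U=\max\{\max_{k\in\mathcal K}\|u(\cdot,k)\|,\ \max_{j\ge1}U_j\}<\infty$. **Multifidelity approximation.** For $k\in\mathcal K$ let $\boldsymbol v_1(k)=(v_{1,1}(k),\dots,v_{1,n}(k))\in\mathbb R^n$ be the least-squares solution $\boldsymbol v_1(k)=\operatorname{argmin}_{\boldsymbol w\in\mathbb R^n}\|u_1(\cdot,k)-\sum_{q=1}^nw_qu_1(\cdot,k_q)\|_1$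 in $H_1$ (here $\|\cdot\|_1$ is the norm of $H_1$), equivalently the solution of $\boldsymbol G_1\boldsymbol v_1=\boldsymbol f_1(k)$ with $(G_1)_{a,b}=\langle u_1(\cdot,k_b),u_1(\cdot,k_a)\rangle_1$ and $(f_1)_a(k)=\langle u_1(\cdot,k),u_1(\cdot,k_a)\rangle_1$. For every $j\ge1$, $\widehat u_j(i,k)=\sum_{q=1}^nv_{1,q}(k)\,u_j(i,k_q)$, $i\in[N_j]$.
   Formalization: L is taken to bound the solutions u themselves (U^(0)) as well as f and its total time derivatives along solutions (U^(s), 1≤s≤p), so C(T,L,p) may depend on U^(0); with L bounding only derivatives of f the claim fails (e.g. u=Λ+kt³, Λ→∞). *)

(* Defs.v *)
From HB Require Import structures.
From mathcomp Require Import all_boot all_order all_algebra qpoly.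
From mathcomp Require Import all_classical all_reals all_analysis.
Set Implicit Arguments.
Unset Strict Implicit.
Unset Printing Implicit Defensive.
Import Order.TTheory GRing.Theory Num.Theory.
Import numFieldNormedType.Exports.
Local Open Scope classical_set_scope.
Local Open Scope ring_scope.

(* Vectors of R^M are row vectors; the component m of v is [v 0 m].  A function
   of (t, k) is written [u t k], with k in R^d. *)

Section TimeDerivatives.
Context {R : realType}.
Implicit Types (A : set R) (g : R -> R).

(* Derivatives relative to the set A, hence one-sided at the end points when A
   is a closed interval: nothing is asked of functions outside [0, T]. *)
Definition diff_quot_in A g (t : R) : set_system R :=
  (x - t)^-1 * (g x - g t) @[x --> within A t^'].

Definition derive_in A g (t : R) : R := lim (diff_quot_in A g t).

Definition deriven_in A (s : nat) g : R -> R := iter s (derive_in A) g.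

Definition derivablen_in A (p : nat) g : Prop :=
  forall s t, (s < p)%N -> A t -> cvg (diff_quot_in A (deriven_in A s g) t).

End TimeDerivatives.

Section Ode.
Context {R : realType} {d M : nat}.
Variables (T : R) (K : set 'rV[R]_d).
Variables (f : R -> 'rV[R]_M -> 'rV[R]_d -> 'rV[R]_M) (u0 : 'rV[R]_d -> 'rV[R]_M).

Definition solves_ode (k : 'rV[R]_d) (y : R -> 'rV[R]_M) : Prop :=
  y 0 = u0 k /\
  forall t m, t \in `[0, T] -> diff_quot_in `[0, T]%classic (fun x => y x 0 m) t --> f t (y t) k 0 m.

(* the quantity U^(s) *)
Definition time_deriv_sup (u : R -> 'rV[R]_d -> 'rV[R]_M) (s : nat) : \bar R :=
  ereal_sup [set y | exists k m t, [/\ K k, t \in `[0, T] &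
    y = `|deriven_in `[0, T]%classic s (fun x => u x k 0 m) t|%:E]].

Record ode_assumptions (p : nat) (u : R -> 'rV[R]_d -> 'rV[R]_M) : Prop := {
  ode_solution : forall k, K k -> solves_ode k (u^~ k);
  ode_unique : forall k y, K k -> solves_ode k y ->
    forall t, t \in `[0, T] -> y t = u t k;
  ode_smooth : forall k m, K k -> derivablen_in `[0, T]%classic p (fun t => u t k 0 m);
  ode_bounded : forall s, (s <= p)%N -> (time_deriv_sup u s < +oo)%E;
  ode_rhs_continuous : forall t x, t \in `[0, T] -> {within K, continuous (f t x)};
  ode_init_continuous : {within K, continuous u0}
}.

(* L bounds the solutions and, along the solutions, the total time derivatives
   of f of order < p.  As the derivative of order s of t |-> f(t, u(t, k), k)
   is that of order s + 1 of u(., k), this says U^(s) <= L for 0 <= s <= p. *)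
Definition bounds_ode (p : nat) (u : R -> 'rV[R]_d -> 'rV[R]_M) (L : R) : Prop :=
  forall k m t, K k -> t \in `[0, T] ->
    `|u t k 0 m| <= L /\
    forall s, (s < p)%N ->
      `|deriven_in `[0, T]%classic s (fun x => f x (u x k) k 0 m) t| <= L.

End Ode.

Section ContinuousSpace.
Context {R : realType} {M : nat}.
Variable T : R.
Implicit Types g w : R -> 'rV[R]_M.

Definition innerH g w : R :=
  (M%:R * T)^-1 *
  \sum_(m < M) \int[lebesgue_measure]_(t in `[0, T]) (g t 0 m * w t 0 m).

Definition normH g : R := Num.sqrt (innerH g g).

(* membership in the span of e, for continuous representatives on [0, T] *)
Definition in_span n (e : 'I_n -> R -> 'rV[R]_M) w : Prop :=
  exists c : 'I_n -> R, forall t, t \in `[0, T] -> w t = \sum_(q < n) c q *: e q t.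

Definition is_orth_proj n (e : 'I_n -> R -> 'rV[R]_M) g w : Prop :=
  in_span e w /\
  forall v, in_span e v -> innerH (fun t => g t - w t) v = 0.

Definition gramH n (e : 'I_n -> R -> 'rV[R]_M) : 'M[R]_n :=
  \matrix_(a, b) innerH (e b) (e a).

End ContinuousSpace.

Section SingularValues.
Context {R : realType}.

Definition singular_value n (A : 'M[R]_n) : set R :=
  [set s | 0 <= s /\ eigenvalue (A^T *m A) (s ^+ 2)].

Definition sigma_min n (A : 'M[R]_n) : R := inf (singular_value A).

End SingularValues.

Section DiscreteSpace.
Context {R : realType}.

Definition nc_degree (p : nat) : nat := maxn (2 * ((p - 1) %/ 2)) 1.

Definition admissible (p N : nat) : bool := (0 < N)%N && (nc_degree p %| N)%N.

(* N_j = N r^(j-1), for j >= 1 *)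
Definition level (N r j : nat) : nat := (N * r ^ (j - 1))%N.

Definition step (T : R) (N : nat) : R := T / N%:R.

(* weights of the closed (P+1)-point Newton-Cotes rule on [0, P], of nodes
   0, 1, ..., P: integrals of the Lagrange basis polynomials *)
Definition nc_weight (P : nat) (l : 'I_P.+1) : R :=
  \int[lebesgue_measure]_(x in `[0, P%:R])
    (tnth (qpoly.lagrange P.+1 (fun i : nat => i%:R : R)) l : {poly R}).[x].

(* weights on the N + 1 nodes of [0, T] of the composite rule, whose panel b has
   length P h and nodes b P h, ..., (b P + P) h, divided by T *)
Definition quad_weight (p : nat) (T : R) (N : nat) (i : 'I_N.+1) : R :=
  let P := nc_degree p in
  T^-1 * \sum_(b < N %/ P) \sum_(l < P.+1 | (b * P + l == i)%N) step T N * nc_weight l.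

Context {M : nat}.

Definition innerN p (T : R) N (g w : 'I_N.+1 -> 'rV[R]_M) : R :=
  M%:R^-1 * \sum_(i < N.+1) quad_weight p T i * \sum_(m < M) (w i 0 m * g i 0 m).

Definition normN p (T : R) N (g : 'I_N.+1 -> 'rV[R]_M) : R :=
  Num.sqrt (innerN p T g g).

(* [v] minimises |g - sum_q v_q e_q| in the discrete space with N steps *)
Definition is_least_squares p (T : R) N n (e : 'I_n -> 'I_N.+1 -> 'rV[R]_M)
    (g : 'I_N.+1 -> 'rV[R]_M) (v : 'rV[R]_n) : Prop :=
  forall v' : 'rV[R]_n,
    normN p T (fun i => g i - \sum_(q < n) v 0 q *: e q i) <=
    normN p T (fun i => g i - \sum_(q < n) v' 0 q *: e q i).

End DiscreteSpace.

Section Multifidelity.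
Context {R : realType} {d M : nat}.
Variables (p : nat) (T : R) (K : set 'rV[R]_d) (u : R -> 'rV[R]_d -> 'rV[R]_M).

(* [ud N i k] is the discrete solution at time i T / N obtained with N steps of
   length T / N; thus u_j(i, k) is [ud (level N r j) i k]. *)
Variable ud : forall N : nat, 'I_N.+1 -> 'rV[R]_d -> 'rV[R]_M.

(* The numbers of steps N_j, for j >= 1 and N admissible, are exactly the
   admissible numbers. *)
Definition has_global_order (C : R) : Prop :=
  exists2 h0 : R, 0 < h0 & forall N, admissible p N -> step T N < h0 ->
    forall k m (i : 'I_N.+1), K k ->
      `|u (i%:R * step T N) k 0 m - ud i k 0 m| <= C * step T N ^+ p.

Definition U_level (N : nat) : \bar R :=
  ereal_sup [set (normN p T (fun i : 'I_N.+1 => ud i k))%:E | k in K].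

(* the quantity U; it depends on the coarse number of steps N *)
Definition U_all (r N : nat) : \bar R :=
  maxe (ereal_sup [set (normH T (u^~ k))%:E | k in K])
       (ereal_sup [set U_level (level N r j) | j in [set j | (0 < j)%N]]).

(* the approximation on the grid with N steps, for the coefficients v *)
Definition multifid n (kq : 'I_n -> 'rV[R]_d) (v : 'rV[R]_n) N (i : 'I_N.+1) :
    'rV[R]_M :=
  \sum_(q < n) v 0 q *: ud i (kq q).

End Multifidelity.

(* Main.v *)
Require Import Defs.
From HB Require Import structures.
From mathcomp Require Import all_boot all_order all_algebra.
From mathcomp Require Import qpoly ring lra zify.
From mathcomp Require Import all_classical all_reals all_analysis.
Set Implicit Arguments.
Unset Strict Implicit.
Import Order.TTheory GRing.Theory Num.Theory.
Import numFieldNormedType.Exports.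
Local Open Scope classical_set_scope.
Local Open Scope ring_scope.

(** Both functions are combinations of trajectories.  The projection is
    [w = sum_q v_q u(., k_q)] with [G v = f], and the multifidelity approximation
    has the coefficients [v1] of the same normal equations [G1 v1 = f1] written
    with the discrete inner products.  Their difference is
    [sum_q (v - v1)_q u(., k_q) + sum_q v1_q (u - u_j)(., k_q)], at most
    [L |v - v1|_1] plus [|v1|_1] times the error of the integrator at level [j].

    Let [delta] bound the entries of [G - G1] and of [f - f1].  From
    [sigma |x|_2 <= |G x|_2] ([sigma_min_le]) it follows, as soon as
    [n delta <= sigma / 2], that [|v1|_1 <= 2 n U^2 / sigma] and
    [|v - v1|_1 <= 3 n^2 U^2 delta / sigma^2]
    ([normal_equations_perturbation]).  It remains to show that [delta] is at most
    [U h^p] up to a factor that depends on [T] and [L] ([inner_error]).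

    The integrator contributes at most [5 U] times its error
    ([inner_perturbation]).  For the quadrature, the classical bound through the
    [p]-th derivative of the product [u(., k) u(., k')] lacks the factor [U].
    That factor comes from an interpolation inequality: at a scale [lam], the
    Taylor coefficients of order [s] of a trajectory, times [lam^s], are bounded
    by [p] of its values at spacing [lam] plus [L lam^p] ([taylor_coef_le]).  A
    panel of length [l] then has an error of at most [l (l / lam)^p] times the
    product of these sizes for the two trajectories ([panel_product_error]).
    Summed over the panels and averaged over the components, the error is at most
    [(l / lam)^p (U^2 + L^2 lam^(2p))] ([inner_quad_error]), and the choice
    [lam^p ~ U / L] leaves [L U l^p].  Taking [lam] among the multiples of [l]
    keeps all the sampled values on the grid, where the discrete norm bounds
    them; the condition on [h] makes room for such a [lam]. *)

(** * Derivatives relative to a segment and Taylor polynomials *)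

Section Taylor.
Context {R : realType}.
Variable T : R.
Hypothesis T0 : 0 < T.
Local Notation A := (`[0, T]%classic : set R).
Implicit Types (g : R -> R) (q : {poly R}).

Lemma diff_quot_inP g t l : diff_quot_in A g t --> l <->
  forall e, 0 < e -> \forall x \near t, x != t -> A x ->
    `|l - (x - t)^-1 * (g x - g t)| < e.
Proof.
split=> [/cvgrPdist_lt H e e0|H].
  by have := H e e0.
by apply/cvgrPdist_lt => e e0; exact: H.
Qed.

(** Limits relative to the segment are unique: every point of a segment of
    positive length is an accumulation point. *)
Lemma within_dnbhs_proper t : A t -> ProperFilter (within A t^').
Proof.
rewrite /= in_itv /= => /andP[t0 tT].
apply: Build_ProperFilter_ex => /= P.
rewrite /within /= => /nbhs_ballP[e /= e0 H].
case: (ltP t T) => tT'.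
  pose d := Num.min (e / 2) ((T - t) / 2).
  have d0 : 0 < d by rewrite lt_min !divr_gt0 ?subr_gt0.
  exists (t + d); apply: H.
  - rewrite /ball /= opprD addrA subrr add0r normrN gtr0_norm //.
    have : d <= e / 2 by rewrite ge_min lexx.
  by move=> de; lra.
  - by rewrite -subr_eq0 addrAC subrr add0r gt_eqF.
  - have : d <= (T - t) / 2 by rewrite ge_min lexx orbT.
    by rewrite /= in_itv /= => dT; apply/andP; split; lra.
pose d := Num.min (e / 2) (t / 2).
have t0' : 0 < t := lt_le_trans T0 tT'.
have d0 : 0 < d by rewrite lt_min !divr_gt0.
exists (t - d); apply: H.
- rewrite /ball /= opprD addrA subrr add0r opprK gtr0_norm //.
  have : d <= e / 2 by rewrite ge_min lexx.
  by move=> de; lra.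
- by rewrite -subr_eq0 addrAC subrr add0r oppr_eq0 gt_eqF.
- have : d <= t / 2 by rewrite ge_min lexx orbT.
  by rewrite /= in_itv /= => dT; apply/andP; split; lra.
Qed.

Lemma derive_inE g t l : A t -> diff_quot_in A g t --> l -> derive_in A g t = l.
Proof.
move=> At; have ? := within_dnbhs_proper At.
by move=> H; rewrite /derive_in; apply: cvg_lim.
Qed.

Lemma eq_diff_quot_in g1 g2 t : A t -> {in A, g1 =1 g2} ->
  diff_quot_in A g1 t = diff_quot_in A g2 t.
Proof.
move=> At e; apply/seteqP; split=> P; rewrite /diff_quot_in /= ?nbhs_filterE /fmap /=;
  apply: (@filterS _ t^') => x H Ax; have := H Ax; rewrite /= !e ?inE //.
Qed.

Lemma eq_deriven_in s g1 g2 : {in A, g1 =1 g2} ->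
  {in A, deriven_in A s g1 =1 deriven_in A s g2}.
Proof.
move=> e; elim: s => [|s IH] //= t; rewrite inE => At.
by rewrite /deriven_in /= /derive_in (eq_diff_quot_in At IH).
Qed.

Lemma diff_quot_in_is_derive g t l : t \in `]0, T[ ->
  diff_quot_in A g t --> l -> is_derive t 1 g l.
Proof.
rewrite in_itv /= => /andP[t0 tT] /diff_quot_inP H.
have C : h^-1 *: (g (h *: 1 + t) - g t) @[h --> 0^'] --> l.
  apply/cvgrPdist_lt => e e0.
  have {}H := H e e0.
  have HA : \forall x \near t, A x.
    near=> x; rewrite /= in_itv /=; apply/andP; split; apply/ltW; near: x.
      exact: lt_nbhsr.
    exact: lt_nbhsl.
  have : \forall x \near t, x != t -> `|l - (x - t)^-1 * (g x - g t)| < e.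
    near=> x => xt.
    by have Ax : A x; [near: x|move: xt Ax; near: x].
  rewrite (near_shift 0 t) subr0 /= => K.
  near=> h.
  have h0 : h + t != t by rewrite -subr_eq0 addrK; near: h; exact: nbhs_dnbhs_neq.
  have Kh : h + t != t -> `|l - (h + t - t)^-1 * (g (h + t) - g t)| < e.
    by near: h; apply: nbhs_dnbhs.
  by have := Kh h0; rewrite addrK (_ : h *: (1 : R) = h) // [LHS]mulr1.
have D : derivable g t 1 by apply/cvg_ex; exists l.
by apply: DeriveDef => //; exact: cvg_lim.
Unshelve. all: by end_near. Qed.

Lemma diff_quot_in_continuous g t (l : R) : A t ->
  diff_quot_in A g t --> l -> g x @[x --> within A (nbhs t)] --> g t.
Proof.
move=> At /diff_quot_inP H.
apply/cvgrPdist_lt => e e0.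
have H1 := H 1 ltr01.
have H2 : \forall x \near t, `|x - t| < e / (`|l| + 1).
  near=> x; rewrite distrC; near: x; apply: nbhsx_ballx => //.
  by rewrite divr_gt0 // ltr_wpDl.
apply: (@filterS2 R (nbhs t) _ _ _ _ _ H1 H2) => x K d Ax.
have [->|xt] := eqVneq x t; first by rewrite subrr normr0.
have {}K := K xt Ax.
have K2 : `|(x - t)^-1 * (g x - g t)| < `|l| + 1.
  rewrite -[X in `|X|](subKr l); apply: le_lt_trans (ler_normB _ _) _.
  by rewrite ltrD2l.
have xt' : x - t != 0 by rewrite subr_eq0.
have -> : g t - g x = - ((x - t) * ((x - t)^-1 * (g x - g t))).
  by rewrite mulVKf // opprB.
rewrite normrN normrM.
move: d; rewrite ltr_pdivlMr ?ltr_wpDl // => d.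
by apply: le_lt_trans d; rewrite ler_pM2l ?normr_gt0 // ltW.
Unshelve. all: by end_near. Qed.

(** The mean value theorem asks for a two-sided derivative between [a] and [x]
    only, where the relative and the usual derivatives agree. *)
Lemma mean_value_ineq g dg a x D : A a -> A x ->
  (forall t, A t -> diff_quot_in A g t --> dg t) ->
  (forall t, Num.min a x <= t <= Num.max a x -> `|dg t| <= D) ->
  `|g x - g a| <= D * `|x - a|.
Proof.
move=> Aa Ax Hd HD.
wlog ax : a x Aa Ax HD / a <= x.
  move=> W; case: (leP a x) => [/W|/ltW xa]; first exact.
  rewrite distrC [`|x - a|]distrC; apply: W => // t.
  by rewrite minC maxC; exact: HD.
move: Aa Ax; rewrite /= !in_itv /= => /andP[a0 aT] /andP[x0 xT].
have [c] : exists2 c, c \in `[a, x]%R & g x - g a = dg c * (x - a).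
  apply: MVT_segment => //.
    move=> t; rewrite in_itv /= => /andP[at_ tx].
    apply: diff_quot_in_is_derive; first by rewrite in_itv /=; apply/andP; split; lra.
    by apply: Hd; rewrite /= in_itv /=; apply/andP; split; lra.
  apply: (@continuous_subspaceW _ _ _ A).
    by move=> t; rewrite /= !in_itv /= => /andP[? ?]; apply/andP; split; lra.
  apply/subspace_continuousP => t At; exact: (diff_quot_in_continuous At (Hd t At)).
rewrite in_itv /= => ac ->; rewrite normrM ler_wpM2r //.
by apply: HD; rewrite min_l // max_r.
Qed.

Lemma diff_quot_inB_poly g q t l : A t -> diff_quot_in A g t --> l ->
  diff_quot_in A (fun x => g x - q.[x]) t --> l - q^`().[t].
Proof.
move=> At H.
have Hq : diff_quot_in A (horner q) t --> q^`().[t].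
  apply/diff_quot_inP => e e0.
  have [Hl El] := is_derive_poly q t.
  have {El Hl} : h^-1 *: (q.[h *: 1 + t] - q.[t]) @[h --> 0^'] --> q^`().[t].
    by rewrite -El; exact: Hl.
  move=> /cvgrPdist_lt /(_ e e0).
  rewrite {1}/dnbhs /within /= => K.
  rewrite (near_shift 0 t) subr0 /=.
  apply: (@filterS R (nbhs (0 : R)) _ _ _ _ K) => h {}K ht Ah.
  have h0 : h != 0 by apply: contraNneq ht => ->; rewrite add0r.
  by have := K h0; rewrite addrK (_ : h *: (1 : R) = h) // [LHS]mulr1.
rewrite /diff_quot_in (_ : (fun x => _) =
  (fun x => (x - t)^-1 * (g x - g t) - (x - t)^-1 * (q.[x] - q.[t]))); last first.
  by apply/funext => x; ring.
have := within_dnbhs_proper At => PF.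
exact: cvgB H Hq.
Qed.

Definition primitive_poly (q : {poly R}) : {poly R} :=
  \poly_(i < (size q).+1) (if i is j.+1 then q`_j / j.+1%:R else 0).

Lemma deriv_primitive_poly q : (primitive_poly q)^`() = q.
Proof.
apply/polyP => i; rewrite coef_deriv coef_poly ltnS.
case: ltnP => [_|/leq_sizeP/(_ _ (leqnn _)) ->]; last by rewrite mul0rn.
by rewrite /= -[LHS]mulr_natr divfK // pnatr_eq0.
Qed.

Lemma primitive_poly0 q : (primitive_poly q).[0] = 0.
Proof. by rewrite horner_coef0 coef_poly. Qed.

(** Integrate the polynomial that approximates the derivative; the mean value
    inequality bounds what is left by [L |x - a|^p]. *)
Lemma taylor_poly (L : R) p g :
  derivablen_in A p g -> (forall t, A t -> `|deriven_in A p g t| <= L) ->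
  forall a, A a -> exists2 q : {poly R}, (size q <= p)%N &
    forall x, A x -> `|g x - q.[x - a]| <= L * `|x - a| ^+ p.
Proof.
elim: p g => [|p IH] g Hd HL a Aa.
  exists 0; first by rewrite size_poly0.
  by move=> x Ax; rewrite horner0 subr0 expr0 mulr1; exact: HL.
have [||q sq Hq] := IH (derive_in A g) _ _ a Aa.
- move=> s t sp At; have := Hd s.+1 t sp At.
  by rewrite /deriven_in iterSr.
- by move=> t At; have := HL t At; rewrite /deriven_in iterSr.
exists ((g a)%:P + primitive_poly q).
  rewrite (leq_trans (size_polyD _ _)) // geq_max (leq_trans (size_polyC_leq1 _)) //=.
  by rewrite (leq_trans (size_poly _ _)).
move=> x Ax.
pose r := (primitive_poly q) \Po ('X - a%:P).
have Hr t : r.[t] = (primitive_poly q).[t - a].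
  by rewrite horner_comp hornerXsubC.
have dr : r^`() = q \Po ('X - a%:P).
  by rewrite deriv_comp deriv_primitive_poly derivXsubC mulr1.
have -> : g x - ((g a)%:P + primitive_poly q).[x - a] = (g x - r.[x]) - (g a - r.[a]).
  by rewrite hornerD hornerC !Hr subrr primitive_poly0; ring.
rewrite exprSr mulrA.
apply: (@mean_value_ineq (fun x => g x - r.[x])
   (fun t => derive_in A g t - r^`().[t])) => //.
  move=> t At; apply: diff_quot_inB_poly => //.
  exact: (Hd 0%N).
move=> t axt.
have At : A t.
  move: axt Aa Ax; rewrite /= !in_itv /=.
  by rewrite /Num.min /Num.max; case: (ltP a x) => ? ? ? ?; apply/andP; split; lra.
rewrite dr horner_comp hornerXsubC.
have L0 : 0 <= L by apply: le_trans (HL a Aa).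
apply: le_trans (Hq t At) _; rewrite ler_wpM2l //.
apply: lerXn2r; rewrite ?nnegrE //.
move: axt; rewrite /Num.min /Num.max; case: (ltP a x) => ax /andP[? ?].
  by rewrite !ger0_norm; lra.
by rewrite !ler0_norm; lra.
Qed.

End Taylor.

(** * Coefficients and values of polynomials *)

Section PolynomialValues.
Context {R : realType}.
Implicit Types q : {poly R}.

(** Lagrange interpolation: the constant is made of the coefficients of the
    Lagrange basis at the nodes 0, ..., n - 1. *)
Lemma coef_le_values n : exists2 C : R, 0 <= C & forall q, (size q <= n)%N ->
  forall s, `|q`_s| <= C * \sum_(i < n) `|q.[i%:R]|.
Proof.
case: n => [|n].
  by exists 0 => // q; rewrite leqn0 size_poly_eq0 => /eqP -> s;
    rewrite coef0 normr0 mul0r.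
pose ell := (@lagrange R n.+1 (fun i => i%:R)).
exists (\sum_(i < n.+1) \sum_(s < n.+1) `|(tnth ell i : {poly R})`_s|).
  by do 2 apply: sumr_ge0 => ? _.
move=> q sq s.
have inj : injective (fun i : nat => i%:R : R) by apply: mulrIn; rewrite oner_eq0.
have E := @lagrange_gen R n.+1 (fun i => i%:R) isT inj q sq.
case: (ltnP s n.+1) => sn; last first.
  rewrite nth_default ?(leq_trans sq) // normr0.
  by rewrite mulr_ge0 // !sumr_ge0 // => ? _; rewrite ?sumr_ge0.
have -> : `|q`_s| = `|(\sum_(i < n.+1) q.[i%:R]%:P * (tnth ell i : {poly R}))`_s|.
  by rewrite -E.
rewrite coef_sum mulr_sumr.
apply: le_trans (ler_norm_sum _ _ _) _; apply: ler_sum => i _.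
rewrite coefCM normrM mulrC; apply: ler_pM => //.
rewrite (bigD1 i) //= (bigD1 (Ordinal sn)) //= -addrA lerDl.
by rewrite addr_ge0 ?sumr_ge0 // => ? _; rewrite sumr_ge0.
Qed.

(** Substitute [x X] for [X]. *)
Lemma scaled_coef_le_values n : exists2 C : R, 0 <= C & forall q, (size q <= n)%N ->
  forall x s, `|q`_s * x ^+ s| <= C * \sum_(i < n) `|q.[i%:R * x]|.
Proof.
have [C C0 HC] := coef_le_values n; exists C => // q sq x s.
pose q' := \poly_(s < n) (q`_s * x ^+ s).
have E i : q'.[i] = q.[i * x].
  rewrite horner_poly (horner_coef_wide _ sq); apply: eq_bigr => j _.
  by rewrite exprMn mulrA mulrAC.
have := HC q' (size_poly _ _) s.
under eq_bigr do rewrite E.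
rewrite coef_poly; case: ltnP => // sn _.
rewrite nth_default ?(leq_trans sq) // mul0r normr0.
by rewrite mulr_ge0 // sumr_ge0.
Qed.

End PolynomialValues.

(** * Integrals on a segment *)

Section Integrals.
Context {R : realType}.
Implicit Types (f g : R -> R) (q r : {poly R}).
Local Notation mu := (@lebesgue_measure R).

Lemma segment_integrable (a b : R) f : {within `[a, b], continuous f} ->
  mu.-integrable `[a, b] (EFin \o f).
Proof. by apply: continuous_compact_integrable; exact: segment_compact. Qed.

Lemma Rintegral_poly (a b : R) q r : a < b -> r^`() = q ->
  \int[mu]_(x in `[a, b]) q.[x] = r.[b] - r.[a].
Proof.
move=> ab dr; rewrite /Rintegral.
rewrite (@continuous_FTC2 _ _ (horner r)) //.
- by apply: continuous_subspaceT => x; exact: continuous_horner.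
- split.
  + by move=> x _; exact: derivable_horner.
  + by apply: cvg_at_right_filter; exact: continuous_horner.
  + by apply: cvg_at_left_filter; exact: continuous_horner.
- by move=> x _; rewrite -derivE dr.
Qed.

Lemma Rintegral_itv_cst (a b c : R) : a <= b ->
  \int[mu]_(x in `[a, b]) c = c * (b - a).
Proof.
move=> ab; rewrite Rintegral_cst //.
rewrite [X in fine X](_ : _ = if a%:E < b%:E then b%:E - a%:E else 0)%E; last first.
  exact: (@lebesgue_measure_itv R `[a, b]).
rewrite lte_fin.
by move: ab; rewrite le_eqVlt => /orP[/eqP ->|->]; rewrite ?ltxx ?subrr ?mulr0.
Qed.

Lemma continuous_within_lincomb (a b : R) n (c : 'I_n -> R) (f : 'I_n -> R -> R) :
  (forall i, {within `[a, b], continuous (f i)}) ->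
  {within `[a, b], continuous (fun x => \sum_(i < n) c i * f i x)}.
Proof.
elim: n c f => [|n IH] c f cf.
  apply: continuous_subspaceT; rewrite (_ : (fun x => _) = cst 0); first exact: cst_continuous.
  by apply/funext => x; rewrite big_ord0.
rewrite (_ : (fun x => _) = (fun x => c ord0 * f ord0 x +
    \sum_(i < n) c (lift ord0 i) * f (lift ord0 i) x)); last first.
  by apply/funext => x; rewrite big_ord_recl.
move=> x; apply: cvgD; last exact: IH.
by apply: cvgM; [exact: cvg_cst|exact: cf].
Qed.

Lemma Rintegral_lincomb (a b : R) n (c : 'I_n -> R) (f : 'I_n -> R -> R) :
  (forall i, {within `[a, b], continuous (f i)}) ->
  \int[mu]_(x in `[a, b]) (\sum_(i < n) c i * f i x) =
  \sum_(i < n) c i * \int[mu]_(x in `[a, b]) f i x.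
Proof.
elim: n c f => [|n IH] c f cf.
  rewrite big_ord0; under eq_Rintegral do rewrite big_ord0.
  by rewrite Rintegral_cst // mul0r.
rewrite big_ord_recl -IH //; under eq_Rintegral do rewrite big_ord_recl.
rewrite RintegralD ?RintegralZl //.
- exact: segment_integrable.
- by apply: segment_integrable => x; apply: cvgM; [exact: cvg_cst|exact: cf].
- by apply: segment_integrable; exact: continuous_within_lincomb.
Qed.

Lemma primitive_poly_Xn s (x : R) :
  (primitive_poly ('X^s)).[x] = x ^+ s.+1 / s.+1%:R.
Proof.
rewrite horner_poly size_polyXn big_ord_recl /= mul0r add0r.
rewrite big_ord_recr /= big1 ?add0r ?coefXn ?eqxx ?div1r 1?mulrC //.
by move=> i _; rewrite coefXn (ltn_eqF (ltn_ord i)) mul0r mul0r.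
Qed.

End Integrals.

(** * The Newton-Cotes weights *)

Section NewtonCotes.
Context {R : realType}.
Local Notation mu := (@lebesgue_measure R).

(** A polynomial of degree at most [P] is its own Lagrange interpolant, and the
    weights are the integrals of the Lagrange basis. *)
Lemma nc_moment P s : (0 < P)%N -> (s <= P)%N ->
  \sum_(l < P.+1) nc_weight l * (l%:R : R) ^+ s = P%:R ^+ s.+1 / s.+1%:R.
Proof.
move=> P0 sP.
pose ell := (@lagrange R P.+1 (fun i => i%:R)).
have inj : injective (fun i : nat => i%:R : R) by apply: mulrIn; rewrite oner_eq0.
have E := @lagrange_gen R P.+1 (fun i => i%:R) isT inj 'X^s.
rewrite size_polyXn ltnS in E; have {}E := E sP.
have P0' : 0 < P%:R :> R by rewrite ltr0n.
have := Rintegral_poly P0' (deriv_primitive_poly 'X^s).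
rewrite primitive_poly0 subr0 primitive_poly_Xn => <-.
rewrite {1}E.
under [RHS]eq_Rintegral do rewrite horner_sum.
under [RHS]eq_Rintegral do under eq_bigr do rewrite hornerCM hornerXn.
rewrite Rintegral_lincomb; first by apply: eq_bigr => l _; rewrite mulrC.
by move=> l; apply: continuous_subspaceT => x; exact: continuous_horner.
Qed.

(** The moments of degree at most [P] form a Vandermonde system, which
    determines the weights: trapezoidal, Simpson and Boole rules. *)
Lemma nc_weights1 : forall l : 'I_2, nc_weight l = 1 / 2 :> R.
Proof.
have := @nc_moment 1 0 isT isT; have := @nc_moment 1 1 isT isT.
rewrite !(big_ord_recl, big_ord0) /= => M1 M0 l.
have : l = ord0 \/ l = lift ord0 ord0.
  by case: l => [[|[|//]] i]; [left|right]; exact/val_inj.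
by case=> ->; rewrite /bump /= in M0 M1 *; lra.
Qed.

Lemma nc_weights2 (l : 'I_3) :
  nc_weight l = nth 0 [:: 1 / 3; 4 / 3; 1 / 3] l :> R.
Proof.
have := @nc_moment 2 0 isT isT; have := @nc_moment 2 1 isT isT.
have := @nc_moment 2 2 isT isT.
rewrite !(big_ord_recl, big_ord0) /= => M2 M1 M0.
have : l = ord0 \/ l = lift ord0 ord0 \/ l = lift ord0 (lift ord0 ord0).
  by case: l => [[|[|[|//]]] i]; [left|right; left|right; right]; exact/val_inj.
by case=> [|[|]] ->; rewrite /bump /= in M0 M1 M2 *; lra.
Qed.

Lemma nc_weights4 (l : 'I_5) :
  nc_weight l = nth 0 [:: 14 / 45; 64 / 45; 24 / 45; 64 / 45; 14 / 45] l :> R.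
Proof.
have := @nc_moment 4 0 isT isT; have := @nc_moment 4 1 isT isT.
have := @nc_moment 4 2 isT isT; have := @nc_moment 4 3 isT isT.
have := @nc_moment 4 4 isT isT.
rewrite !(big_ord_recl, big_ord0) /= => M4 M3 M2 M1 M0.
have : l = ord0 \/ l = lift ord0 ord0 \/ l = lift ord0 (lift ord0 ord0) \/
   l = lift ord0 (lift ord0 (lift ord0 ord0)) \/
   l = lift ord0 (lift ord0 (lift ord0 (lift ord0 ord0))).
  by case: l => [[|[|[|[|[|//]]]]] i];
    [left|right; left|right; right; left|right; right; right; left|
     right; right; right; right]; exact/val_inj.
by case=> [|[|[|[|]]]] ->; rewrite /bump /= in M0 M1 M2 M3 M4 *; lra.
Qed.

(** For even [P] the symmetry of the nodes gives one more degree of exactness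
    than interpolation does, which is what [p = P + 2] asks for.  The constant
    3 / 10 is below the first weights 1 / 2, 1 / 3 and 14 / 45. *)
Lemma nc_weightsP p : (2 <= p <= 6)%N ->
  let P := nc_degree p in
  [/\ forall s, (s < p)%N ->
      \sum_(l < P.+1) nc_weight l * (l%:R : R) ^+ s = P%:R ^+ s.+1 / s.+1%:R,
      forall l : 'I_P.+1, 0 <= nc_weight l :> R &
      3 / 10 <= nc_weight (ord0 : 'I_P.+1) :> R ].
Proof.
move=> hp P.
have : [\/ P = 1%N /\ (p <= 2)%N, P = 2%N /\ (p <= 4)%N | P = 4%N].
  rewrite /P; move: p hp {P} => [|[|[|[|[|[|[|p]]]]]]] //= _.
  - by apply: Or31.
  - by apply: Or32.
  - by apply: Or32.
  - by apply: Or33.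
  - by apply: Or33.
case=> [[-> p2]|[-> p4]|P4].
- split=> [s sp|l|]; last by rewrite nc_weights1; lra.
    by apply: nc_moment => //; lia.
  by rewrite nc_weights1; lra.
- split=> [s sp|l|]; last by rewrite nc_weights2 /=; lra.
    have [s2|s3] := leqP s 2; first exact: nc_moment.
    have -> : s = 3%N by lia.
    rewrite !(big_ord_recl, big_ord0) /= !nc_weights2 /bump /=; lra.
  by rewrite nc_weights2; case: l => [[|[|[|//]]] i] /=; lra.
- rewrite P4; split=> [s sp|l|]; last by rewrite nc_weights4 /=; lra.
    have [s4|s5] := leqP s 4; first exact: nc_moment.
    have -> : s = 5%N by lia.
    rewrite !(big_ord_recl, big_ord0) /= !nc_weights4 /bump /=; lra.
  by rewrite nc_weights4; case: l => [[|[|[|[|[|//]]]]] i] /=; lra.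
Qed.

End NewtonCotes.

(** * Elementary inequalities *)

Section Elementary.
Context {R : realType}.

Lemma le_of_eq (x y : R) : x = y -> x <= y.
Proof. by move=> ->. Qed.

(** Completing the square; it turns a bound on a mean square into one on a mean
    without a Cauchy-Schwarz inequality. *)
Lemma abs_le_sqr (x m : R) : 0 < m -> `|x| <= (4 * m)^-1 * x ^+ 2 + m.
Proof.
move=> m0; rewrite -[x ^+ 2]real_normK ?num_real //; set y := `|x|.
rewrite -subr_ge0 (_ : _ - _ = (4 * m)^-1 * (y - 2 * m) ^+ 2); last first.
  by field; rewrite gt_eqF.
by rewrite mulr_ge0 ?sqr_ge0 // invr_ge0 mulr_ge0 // ltW.
Qed.

Lemma ler_sum_const n (Q : pred 'I_n) (F : 'I_n -> R) c :
  0 <= c -> (forall i, Q i -> F i <= c) -> \sum_(i < n | Q i) F i <= n%:R * c.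
Proof.
move=> c0 Fc; apply: le_trans (ler_sum _ Fc) _.
rewrite sumr_const -[c *+ _]mulr_natl ler_wpM2r // ler_nat.
by rewrite -[X in (_ <= X)%N]card_ord max_card.
Qed.

Lemma sqr_sum_le n (a : 'I_n -> R) :
  (\sum_(i < n) a i) ^+ 2 <= n%:R * \sum_(i < n) a i ^+ 2.
Proof.
rewrite expr2 big_distrlr /=.
pose f i := a i ^+ 2 / 2.
apply: le_trans (_ : \sum_(i < n) \sum_(j < n) (f i + f j) <= _).
  apply: ler_sum => i _; apply: ler_sum => j _.
  by have := sqr_ge0 (a i - a j); rewrite /f; lra.
have -> : \sum_(i < n) a i ^+ 2 = \sum_(i < n) f i + \sum_(i < n) f i.
  by rewrite -big_split; apply: eq_bigr => i _ /=; rewrite /f; lra.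
under eq_bigr do rewrite big_split /= sumr_const card_ord.
rewrite big_split /= sumr_const card_ord sumrMnl -mulrnDl.
by rewrite mulr_natl.
Qed.

Lemma ler_sum_inj B (Q : pred 'I_B) (F : nat -> R) (phi : nat -> nat) :
  (forall i, 0 <= F i) -> (forall b, Q b -> (phi b < B)%N) ->
  (forall b c, Q b -> Q c -> phi b = phi c -> b = c) ->
  \sum_(b < B | Q b) F (phi b) <= \sum_(b < B) F b.
Proof.
move=> F0 Hlt Hinj.
pose h (b : 'I_B) := insubd b (phi b).
have hE b : Q b -> val (h b) = phi b by move=> /Hlt lt; rewrite val_insubd lt.
have -> : \sum_(b < B | Q b) F (phi b) = \sum_(b in Q) F (h b).
  by apply: eq_big => // b Qb; rewrite hE.
rewrite -(@big_imset _ _ _ _ _ h (mem Q) (fun b : 'I_B => F b)) /=; last first.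
  move=> b c Qb Qc e; apply: Hinj => //.
  by rewrite -!hE // e.
by rewrite [X in _ <= X](bigID (mem [set h x | x in Q]%SET)) /= lerDl sumr_ge0.
Qed.

End Elementary.

(** * The product of two Taylor polynomials *)

Section ProductTaylor.
Context {R : realType}.
Implicit Types q r : {poly R}.

Definition truncated_product p q r : {poly R} :=
  \sum_(i < p) \sum_(j < p | (i + j < p)%N) (q`_i * r`_j) *: 'X^(i + j).

Lemma size_truncated_product p q r : (size (truncated_product p q r) <= p)%N.
Proof.
rewrite (leq_trans (size_sum _ _ _)) //; apply/bigmax_leqP => i _.
rewrite (leq_trans (size_sum _ _ _)) //; apply/bigmax_leqP => j ij.
by rewrite (leq_trans (size_scale_leq _ _)) // size_polyXn.
Qed.

Lemma horner_scaled_le p q (F z lam : R) : (size q <= p)%N -> 0 < lam ->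
  0 <= z <= lam -> (forall s, `|q`_s * lam ^+ s| <= F) -> `|q.[z]| <= p%:R * F.
Proof.
move=> sq l0 /andP[z0 zl] HF.
rewrite (horner_coef_wide _ sq); apply: le_trans (ler_norm_sum _ _ _) _.
apply: ler_sum_const => [|i _]; first exact: le_trans (HF 0%N).
apply: le_trans (HF i); rewrite !normrM ler_wpM2l //.
by rewrite !normrX (ger0_norm z0) (gtr0_norm l0) lerXn2r // nnegrE // ltW.
Qed.

(** Read at the scale [lam], the coefficients of [q] and [r] are at most [F] and
    [G], so each monomial of degree at least [p] of the product is at most
    [(ell / lam) ^ p * (F * G)] on [[0, ell]]. *)
Lemma truncated_product_approx p q r (x y z ell lam F G : R) :
  (size q <= p)%N -> (size r <= p)%N -> 0 <= z <= ell -> 0 < ell <= lam ->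
  (forall s, `|q`_s * lam ^+ s| <= F) -> (forall s, `|r`_s * lam ^+ s| <= G) ->
  `|x - q.[z]| <= (ell / lam) ^+ p * F -> `|y - r.[z]| <= (ell / lam) ^+ p * G ->
  `|x * y - (truncated_product p q r).[z]| <=
    (p%:R * p%:R + p%:R + p%:R + 1) * ((ell / lam) ^+ p * (F * G)).
Proof.
move=> sq sr /andP[z0 zl] /andP[e0 el] HF HG Hx Hy.
have l0 : 0 < lam by apply: lt_le_trans el.
have F0 : 0 <= F by apply: le_trans (HF 0%N).
have G0 : 0 <= G by apply: le_trans (HG 0%N).
set tau := ell / lam.
have t0 : 0 <= tau by rewrite divr_ge0 ?ltW.
have t1 : tau <= 1 by rewrite ler_pdivrMr // mul1r.
have tp0 : 0 <= tau ^+ p by rewrite exprn_ge0.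
have tp1 : tau ^+ p <= 1 by rewrite exprn_ile1.
have Eqr : q.[z] * r.[z] - (truncated_product p q r).[z] =
   \sum_(i < p) \sum_(j < p | (p <= i + j)%N) q`_i * r`_j * z ^+ (i + j).
  rewrite (horner_coef_wide _ sq) (horner_coef_wide _ sr) mulr_suml.
  rewrite /truncated_product horner_sum -sumrB; apply: eq_bigr => i _.
  rewrite mulr_sumr horner_sum (bigID (fun j : 'I_p => (p <= i + j)%N)) /=.
  under [X in _ - X]eq_bigl do rewrite ltnNge.
  rewrite [X in _ - X](eq_bigr (fun j : 'I_p => q`_i * z ^+ i * (r`_j * z ^+ j))); last first.
    by move=> j _; rewrite hornerZ hornerXn exprD; ring.
  by rewrite addrK; apply: eq_bigr => j _; rewrite exprD; ring.
have B1 : `|q.[z] * r.[z] - (truncated_product p q r).[z]| <=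
    p%:R * p%:R * (tau ^+ p * (F * G)).
  rewrite Eqr; apply: le_trans (ler_norm_sum _ _ _) _.
  have c0 : 0 <= tau ^+ p * (F * G) by rewrite !mulr_ge0.
  rewrite -mulrA; apply: ler_sum_const => [|i _]; first by rewrite mulr_ge0.
  apply: le_trans (ler_norm_sum _ _ _) _; apply: ler_sum_const => // j ij.
  have -> : q`_i * r`_j * z ^+ (i + j) =
     (z / lam) ^+ (i + j) * ((q`_i * lam ^+ i) * (r`_j * lam ^+ j)).
    by rewrite expr_div_n !exprD; field; rewrite !expf_neq0 // gt_eqF.
  have zt0 : 0 <= z / lam by rewrite divr_ge0 // ltW.
  have zt : z / lam <= tau by rewrite ler_pM2r ?invr_gt0.
  rewrite normrM ger0_norm ?exprn_ge0 //; apply: ler_pM => //.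
  - by rewrite exprn_ge0.
  - apply: (@le_trans _ _ ((z / lam) ^+ p)).
      by apply: ler_wiXn2l ij; rewrite // (le_trans zt).
    by rewrite lerXn2r // nnegrE.
  - by rewrite normrM; apply: ler_pM.
have zlam : 0 <= z <= lam by rewrite z0 (le_trans zl).
have qz := horner_scaled_le sq l0 zlam HF.
have rz := horner_scaled_le sr l0 zlam HG.
have yz : `|y| <= (p%:R + 1) * G.
  rewrite -[y](subrK r.[z]) mulrDl mul1r addrC.
  apply: le_trans (ler_normD _ _) _; rewrite lerD //.
  by apply: le_trans Hy _; rewrite ler_piMl.
have -> : x * y - (truncated_product p q r).[z] =
  (x - q.[z]) * y + q.[z] * (y - r.[z]) + (q.[z] * r.[z] - (truncated_product p q r).[z]).
  by ring.
apply: le_trans (ler_normD _ _) _; apply: le_trans (lerD (ler_normD _ _) B1) _.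
have B2 : `|(x - q.[z]) * y| <= (tau ^+ p * F) * ((p%:R + 1) * G).
  by rewrite normrM; apply: ler_pM.
have B3 : `|q.[z] * (y - r.[z])| <= (p%:R * F) * (tau ^+ p * G).
  by rewrite normrM; apply: ler_pM.
apply: le_trans (lerD (lerD B2 B3) (lexx _)) _.
by apply: le_of_eq; ring.
Qed.

End ProductTaylor.

(** * Quadrature error on one panel *)

Section Panel.
Context {R : realType}.
Variables (p : nat) (T L : R).
Hypothesis hp : (2 <= p <= 6)%N.
Local Notation P := (nc_degree p).
Local Notation mu := (@lebesgue_measure R).

Lemma nc_degree_gt0 : (0 < P)%N.
Proof. by rewrite /nc_degree leq_max orbT. Qed.

Lemma panel_exact (a h : R) (t : {poly R}) : 0 < h -> (size t <= p)%N ->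
  \int[mu]_(x in `[a, a + P%:R * h]) t.[x - a] =
  h * \sum_(l < P.+1) nc_weight l * t.[l%:R * h].
Proof.
move=> h0 st; have [Hex _ _] := @nc_weightsP R p hp.
have P0 : 0 < P%:R :> R by rewrite ltr0n nc_degree_gt0.
under eq_Rintegral do rewrite -[_ - a]hornerXsubC -horner_comp.
rewrite (@Rintegral_poly _ _ _ _ (primitive_poly t \Po ('X - a%:P))); first last.
- by rewrite deriv_comp deriv_primitive_poly derivXsubC mulr1.
- by rewrite ltrDl mulr_gt0.
rewrite !horner_comp !hornerXsubC subrr primitive_poly0 subr0 addrAC subrr add0r.
rewrite horner_poly big_ord_recl /= mul0r add0r.
under [in RHS]eq_bigr do rewrite horner_coef.
rewrite mulr_sumr.
under [in RHS]eq_bigr do rewrite mulr_sumr mulr_sumr.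
rewrite exchange_big /=; apply: eq_bigr => s _.
rewrite /bump /= add1n.
transitivity (t`_s * h ^+ s.+1 * \sum_(l < P.+1) nc_weight l * (l%:R) ^+ s).
  rewrite Hex ?(leq_trans (ltn_ord s)) // exprMn; field.
  by rewrite ?nat1r ?natr1 pnatr_eq0.
rewrite mulr_sumr; apply: eq_bigr => l _.
by rewrite exprMn exprS; ring.
Qed.
End Panel.

Section PanelError.
Context {R : realType}.
Variable p : nat.
Hypothesis hp : (2 <= p <= 6)%N.
Local Notation P := (nc_degree p).
Local Notation mu := (@lebesgue_measure R).
Implicit Types (X Y Z : R -> R) (T L a h x delta : R).

Lemma panel_error (a h eps : R) (g : R -> R) (t : {poly R}) : 0 < h -> (size t <= p)%N ->
  {within `[a, a + P%:R * h], continuous g} ->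
  (forall x, a <= x <= a + P%:R * h -> `|g x - t.[x - a]| <= eps) ->
  `|\int[mu]_(x in `[a, a + P%:R * h]) g x -
    h * \sum_(l < P.+1) nc_weight l * g (a + l%:R * h)| <= 2 * (P%:R * h) * eps.
Proof.
move=> h0 st cg Hg.
have [Hex Hw _] := @nc_weightsP R p hp.
have P0 : 0 < P%:R :> R by rewrite ltr0n nc_degree_gt0.
have Ph0 : 0 < P%:R * h by rewrite mulr_gt0.
have ex := panel_exact hp a h0 st.
have cxa : continuous (fun x : R => t.[x - a]).
  rewrite (_ : (fun x => _) = horner (t \Po ('X - a%:P))); first exact: continuous_horner.
  by apply/funext => x; rewrite horner_comp hornerXsubC.
have ct : {within `[a, a + P%:R * h], continuous (fun x => t.[x - a])}.
  exact: continuous_subspaceT.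
have cd : {within `[a, a + P%:R * h], continuous (fun x => g x - t.[x - a])}.
  by move=> x; apply: cvgB; [exact: cg|exact: ct].
have -> : \int[mu]_(x in `[a, a + P%:R * h]) g x -
    h * \sum_(l < P.+1) nc_weight l * g (a + l%:R * h) =
  \int[mu]_(x in `[a, a + P%:R * h]) (g x - t.[x - a]) -
    h * \sum_(l < P.+1) nc_weight l * (g (a + l%:R * h) - t.[l%:R * h]).
  rewrite RintegralB //; [|exact: segment_integrable..].
  have -> : \sum_(l < P.+1) nc_weight l * (g (a + l%:R * h) - t.[l%:R * h]) =
      \sum_(l < P.+1) nc_weight l * g (a + l%:R * h) -
      \sum_(l < P.+1) nc_weight l * t.[l%:R * h].
    by rewrite -sumrB; apply: eq_bigr => l _; rewrite mulrBr.
  by rewrite ex; ring.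
apply: le_trans (ler_normB _ _) _.
have B1 : `|\int[mu]_(x in `[a, a + P%:R * h]) (g x - t.[x - a])| <= (P%:R * h) * eps.
  apply: le_trans (le_normr_Rintegral _ (segment_integrable cd)) _ => //.
  have -> : P%:R * h * eps = \int[mu]_(x in `[a, a + P%:R * h]) eps.
    by rewrite Rintegral_itv_cst ?lerDl ?ltW //; ring.
  apply: le_Rintegral => //.
  - apply: segment_integrable => x; apply: cvg_norm; exact: cd.
  - by apply: segment_integrable; apply: continuous_subspaceT => x; exact: cvg_cst.
have B2 : `|h * \sum_(l < P.+1) nc_weight l * (g (a + l%:R * h) - t.[l%:R * h])| <=
   (P%:R * h) * eps.
  have W : \sum_(l < P.+1) nc_weight l = P%:R :> R.
    have := Hex 0%N; rewrite expr1 divr1 => <-; last by case/andP: hp => /ltnW.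
    by apply: eq_bigr => l _; rewrite expr0 mulr1.
  have -> : P%:R * h * eps = h * ((\sum_(l < P.+1) nc_weight l) * eps) by rewrite W; ring.
  rewrite normrM (gtr0_norm h0); apply: (ler_wpM2l (ltW h0)); rewrite mulr_suml.
  apply: le_trans (ler_norm_sum _ _ _) _; apply: ler_sum => l _.
  rewrite normrM (ger0_norm (Hw _)) ler_wpM2l //.
  have := Hg (a + l%:R * h); rewrite addrAC subrr add0r; apply.
  apply/andP; split; first by rewrite lerDl mulr_ge0 // ltW.
  by rewrite lerD2l ler_pM2r // ler_nat -ltnS.
by apply: le_trans (lerD B1 B2) _; apply: le_of_eq; ring.
Qed.

(** The trace that the first [p] derivatives leave at [a]: only the polynomial
    matters below, so the derivatives themselves are forgotten. *)
Definition taylor_bounded (T L : R) X := forall a, 0 <= a <= T ->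
  exists2 q : {poly R}, (size q <= p)%N &
    forall x, 0 <= x <= T -> `|X x - q.[x - a]| <= L * `|x - a| ^+ p.

Definition stencil_sum X (a delta : R) := \sum_(i < p) `|X (a + i%:R * delta)|.

(** Interpolation between the size of [X] and the bound [L] of its [p]-th
    derivative: at the scale [delta] the Taylor coefficients are governed by
    [p] values of [X], for the Taylor polynomial takes these values up to
    [L * |delta| ^ p]. *)
Lemma taylor_coef_le : exists2 C : R, 1 <= C &
  forall T L X a delta, 0 <= L -> 0 <= a <= T ->
  (forall i, (i < p)%N -> 0 <= a + i%:R * delta <= T) -> taylor_bounded T L X ->
  exists2 q : {poly R}, (size q <= p)%N &
    (forall x, 0 <= x <= T -> `|X x - q.[x - a]| <= L * `|x - a| ^+ p) /\
    forall s, `|q`_s * `|delta| ^+ s| <=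
      C * (stencil_sum X a delta + L * `|delta| ^+ p).
Proof.
have [C C0 HC] := @scaled_coef_le_values R p.
exists (1 + C * (1 + p%:R * p%:R ^+ p)).
  by rewrite lerDl mulr_ge0 // addr_ge0 // mulr_ge0 // exprn_ge0.
move=> T L X a delta L0 aT HT HX; have [q sq Hq] := HX a aT.
exists q => //; split=> // s.
have -> : `|q`_s * `|delta| ^+ s| = `|q`_s * delta ^+ s|.
  by rewrite !normrM !normrX normr_id.
apply: le_trans (HC q sq delta s) _.
set S := stencil_sum X a delta; set z := L * _.
have S0 : 0 <= S by apply: sumr_ge0.
have z0 : 0 <= z by rewrite mulr_ge0 // exprn_ge0.
have H : \sum_(i < p) `|q.[i%:R * delta]| <= S + p%:R * (p%:R ^+ p * z).
  apply: (@le_trans _ _ (\sum_(i < p) (`|X (a + i%:R * delta)| +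
    `|q.[i%:R * delta] - X (a + i%:R * delta)|))).
    apply: ler_sum => i _.
    by rewrite -[X in `|X|](subrK (X (a + i%:R * delta))) addrC ler_normD.
  rewrite big_split lerD2l; apply: ler_sum_const => [|i _].
    by rewrite mulr_ge0 // exprn_ge0.
  have := Hq (a + i%:R * delta) (HT i (ltn_ord i)).
  rewrite addrAC subrr add0r distrC => /le_trans; apply.
  rewrite normrM exprMn mulrCA ler_wpM2r // normr_nat lerXn2r ?nnegrE //.
  by rewrite ler_nat ltnW.
apply: le_trans (ler_wpM2l C0 H) _.
have pp0 : 0 <= p%:R * p%:R ^+ p :> R by rewrite mulr_ge0 // exprn_ge0.
have E : S + p%:R * (p%:R ^+ p * z) <= (1 + p%:R * p%:R ^+ p) * (S + z).
  rewrite -subr_ge0 (_ : _ - _ = z + p%:R * p%:R ^+ p * S); last by ring.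
  by rewrite addr_ge0 // mulr_ge0.
apply: le_trans (ler_wpM2l C0 E) _.
by rewrite mulrA ler_wpM2r ?addr_ge0 // lerDr.
Qed.

(** The rule integrates exactly the part of degree below [p] of the product of
    the Taylor polynomials.  What remains is small with both factors, each one
    measured by its values on the stencil plus [L * |delta| ^ p]; the [p]-th
    derivative of the product, bounded by a multiple of [L ^ 2], would forget
    how small the functions are. *)
Lemma panel_product_error : exists2 C : R, 0 <= C &
  forall T L X Y a h delta, 0 < h -> 0 <= L -> 0 <= a -> a + P%:R * h <= T ->
  P%:R * h <= `|delta| -> (forall i, (i < p)%N -> 0 <= a + i%:R * delta <= T) ->
  {within `[0, T], continuous X} -> {within `[0, T], continuous Y} ->
  taylor_bounded T L X -> taylor_bounded T L Y ->
  `|\int[mu]_(x in `[a, a + P%:R * h]) (X x * Y x) -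
    h * \sum_(l < P.+1) nc_weight l * (X (a + l%:R * h) * Y (a + l%:R * h))| <=
  C * (P%:R * h) * (P%:R * h / `|delta|) ^+ p *
  ((stencil_sum X a delta + L * `|delta| ^+ p) * (stencil_sum Y a delta + L * `|delta| ^+ p)).
Proof.
have [C C1 HC] := taylor_coef_le.
have C0 : 0 <= C by apply: le_trans C1.
exists (2 * (p%:R * p%:R + p%:R + p%:R + 1) * C ^+ 2).
  by rewrite !mulr_ge0 // ?addr_ge0 // mulr_ge0.
move=> T L X Y a h delta h0 L0 a0 aT hd Hst cX cY HX HY.
have P0 : 0 < P%:R :> R by rewrite ltr0n nc_degree_gt0.
have Ph0 : 0 < P%:R * h by rewrite mulr_gt0.
have d0 : 0 < `|delta| by apply: lt_le_trans hd.
have aT' : 0 <= a <= T by rewrite a0 (le_trans _ aT) // lerDl ltW.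
have [q sq [Hq cq]] := HC T L X a delta L0 aT' Hst HX.
have [r sr [Hr cr]] := HC T L Y a delta L0 aT' Hst HY.
set F : R := stencil_sum X a delta + _ in cq *.
set G : R := stencil_sum Y a delta + _ in cr *.
have sub : `[a, a + P%:R * h] `<=` `[0, T].
  by move=> x; rewrite /= !in_itv /= => /andP[? ?]; apply/andP; split; lra.
have cXY : {within `[a, a + P%:R * h], continuous (fun x => X x * Y x)}.
  apply: (continuous_subspaceW sub) => x.
  by apply: cvgM; [exact: cX|exact: cY].
have Happ Z (x : R) (r' : {poly R}) : a <= x <= a + P%:R * h ->
   (forall x, 0 <= x <= T -> `|Z x - r'.[x - a]| <= L * `|x - a| ^+ p) ->
   `|Z x - r'.[x - a]| <= (P%:R * h / `|delta|) ^+ p *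
      (C * (stencil_sum Z a delta + L * `|delta| ^+ p)).
  move=> ax HZ.
  apply: le_trans (HZ x _) _; first by apply/andP; split; lra.
  apply: (@le_trans _ _ ((P%:R * h / `|delta|) ^+ p * (L * `|delta| ^+ p))).
    rewrite mulrCA ler_wpM2l // -exprMn divfK ?gt_eqF //.
    apply: lerXn2r; rewrite ?nnegrE //; first exact: ltW.
    by rewrite ger0_norm; lra.
  apply: ler_wpM2l; first by rewrite exprn_ge0 // divr_ge0 // ltW.
  apply: (@le_trans _ _ (stencil_sum Z a delta + L * `|delta| ^+ p)).
    by rewrite lerDr sumr_ge0.
  rewrite ler_peMl // addr_ge0 ?sumr_ge0 // mulr_ge0 // exprn_ge0.
set tau := (P%:R * h / `|delta|) ^+ p in Happ *.
pose D : R := p%:R * p%:R + p%:R + p%:R + 1.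
have Hb x : a <= x <= a + P%:R * h ->
    `|X x * Y x - (truncated_product p q r).[x - a]| <= D * (tau * (C * F * (C * G))).
  move=> ax.
  apply: (truncated_product_approx sq sr (ell := P%:R * h) (lam := `|delta|) _ _ cq cr).
  - by apply/andP; split; lra.
  - by rewrite Ph0.
  - exact: Happ.
  - exact: Happ.
apply: le_trans (panel_error h0 (size_truncated_product p q r) cXY Hb) _.
by apply: le_of_eq; rewrite /D -/F -/G; ring.
Qed.

End PanelError.

(** * Quadrature error of the composite rule *)

Section Composite.
Context {R : realType}.
Variable p : nat.
Hypothesis hp : (2 <= p <= 6)%N.
Local Notation P := (nc_degree p).
Local Notation mu := (@lebesgue_measure R).
Implicit Types (X Y g : R -> R) (T L h l x : R).

Lemma Rintegral_panels g l B : 0 < l -> {within `[0, B%:R * l], continuous g} ->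
  \int[mu]_(x in `[0, B%:R * l]) g x =
  \sum_(b < B) \int[mu]_(x in `[b%:R * l, b%:R * l + l]) g x.
Proof.
move=> l0; elim: B => [|B IH] cg.
  by rewrite big_ord0 mul0r set_itv1 Rintegral_set1.
have BS : B.+1%:R * l = B%:R * l + l by rewrite -natr1 mulrDl mul1r.
have Bl : 0 <= B%:R * l by rewrite mulr_ge0 // ltW.
rewrite big_ord_recr /= -IH; last first.
  apply: continuous_subspaceW cg => x; rewrite /= !in_itv /= BS => /andP[? ?].
  by apply/andP; split; lra.
have ig := segment_integrable cg.
have := @Rintegral_itvB R g (BLeft 0) (BRight (B.+1%:R * l)) (B%:R * l) ig.
rewrite !bnd_simp Bl => /(_ isT); rewrite {1}BS lerDl (ltW l0) => /(_ isT).
rewrite Rintegral_itv_obnd_cbnd.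
  by rewrite -BS => <-; rewrite addrC subrK.
apply: integrableS ig => //.
by move=> x; rewrite /= !in_itv /= => /andP[? ?]; apply/andP; split; lra.
Qed.

(** The stencil of the panel [b] leans to the right when there is room, and to
    the left otherwise; as [q] is a number of panels, it lies on the grid. *)
Definition stencil_index B q b i : nat :=
  if (b + p * q < B)%N then (b + i * q)%N else (b - i * q)%N.

Lemma stencil_index_lt B q b i : (i < p)%N -> (b < B)%N ->
  (stencil_index B q b i < B)%N.
Proof.
move=> ip bB; rewrite /stencil_index; case: ifP => [|_]; last first.
  exact: leq_ltn_trans (leq_subr _ _) bB.
by apply: leq_ltn_trans; rewrite leq_add2l leq_mul2r ltnW ?orbT.
Qed.

(** Either branch of [stencil_index] is injective in [b], whence the factor 2. *)
Lemma sum_stencil_le B q i (F : nat -> R) : (i < p)%N -> (2 * (p * q) <= B)%N ->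
  (forall b, 0 <= F b) ->
  \sum_(b < B) F (stencil_index B q b i) <= 2 * \sum_(b < B) F b.
Proof.
move=> ip qB F0.
have iq : (i * q <= p * q)%N by rewrite leq_mul2r ltnW ?orbT.
rewrite (bigID (fun b : 'I_B => (b + p * q < B)%N)) /= mulrDl mul1r; apply: lerD.
  rewrite (eq_bigr (fun b : 'I_B => F (b + i * q)%N)); last first.
    by move=> b Hb; rewrite /stencil_index Hb.
  apply: (ler_sum_inj (phi := fun b => (b + i * q)%N)) => //.
    by move=> b; apply: leq_ltn_trans; rewrite leq_add2l.
  by move=> b c _ _ /addIn/val_inj.
rewrite (eq_bigr (fun b : 'I_B => F (b - i * q)%N)); last first.
  by move=> b Hb; rewrite /stencil_index (negbTE Hb).
apply: (ler_sum_inj (phi := fun b => (b - i * q)%N)) => //.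
  by move=> b _; exact: leq_ltn_trans (leq_subr _ _) _.
by move=> b c Hb Hc e; apply/val_inj => /=; lia.
Qed.

(** The ratio of the panel length to the spacing of the stencil is [1 / q], and
    the sums of squares over the stencils are sums over the grid. *)
Lemma composite_product_error : exists2 C : R, 0 <= C &
  forall B q h L X Y, (0 < q)%N -> (2 * (p * q) <= B)%N -> 0 < h -> 0 <= L ->
  let l := P%:R * h in let T := B%:R * l in
  {within `[0, T], continuous X} -> {within `[0, T], continuous Y} ->
  taylor_bounded p T L X -> taylor_bounded p T L Y ->
  `|\int[mu]_(x in `[0, T]) (X x * Y x) -
    h * \sum_(b < B) \sum_(i < P.+1)
      nc_weight i * (X (b%:R * l + i%:R * h) * Y (b%:R * l + i%:R * h))| <=
  C * q%:R ^- p * (l * \sum_(b < B) (X (b%:R * l) ^+ 2 + Y (b%:R * l) ^+ 2) +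
                   T * (L * (q%:R * l) ^+ p) ^+ 2).
Proof.
have [C C0 HC] := @panel_product_error R p hp.
exists (C * (2 * p%:R ^+ 2)); first by rewrite !mulr_ge0 // exprn_ge0.
move=> B q h L X Y q0 qB h0 L0 l T cX cY HX HY.
have l0 : 0 < l by rewrite mulr_gt0 // ltr0n nc_degree_gt0.
have q0' : 0 < q%:R :> R by rewrite ltr0n.
set z := L * (q%:R * l) ^+ p.
have z0 : 0 <= z by rewrite mulr_ge0 // exprn_ge0 // mulr_ge0 // ltW.
pose S (Z : R -> R) (b : 'I_B) := \sum_(i < p) `|Z ((stencil_index B q b i)%:R * l)|.
have main (b : 'I_B) :
  `|\int[mu]_(x in `[b%:R * l, b%:R * l + l]) (X x * Y x) -
    h * \sum_(i < P.+1) nc_weight i *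
      (X (b%:R * l + i%:R * h) * Y (b%:R * l + i%:R * h))| <=
    C * l * q%:R ^- p * ((S X b + z) * (S Y b + z)).
  pose delta := if (b + p * q < B)%N then q%:R * l else - (q%:R * l).
  have dE : `|delta| = q%:R * l.
    by rewrite /delta; case: ifP => _; rewrite ?normrN gtr0_norm // mulr_gt0.
  have aE i : (i < p)%N -> b%:R * l + i%:R * delta = (stencil_index B q b i)%:R * l.
    move=> ip; rewrite /delta /stencil_index; case: ifP => [_|/negbT Hb].
      by rewrite natrD natrM; ring.
    have iq : (i * q <= p * q)%N by rewrite leq_mul2r ltnW ?orbT.
    by rewrite natrB ?natrM; [ring|lia].
  have SE Z : S Z b = stencil_sum p Z (b%:R * l) delta.
    by apply: eq_bigr => i _; rewrite aE.
  have := HC T L X Y (b%:R * l) h delta h0 L0.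
  rewrite -!SE dE -/z -/l (_ : l / (q%:R * l) = q%:R^-1); last first.
    by rewrite invfM mulrCA divff ?mulr1 // gt_eqF.
  rewrite exprVn mulrAC; apply => //.
  - by rewrite mulr_ge0 // ltW.
  - rewrite (_ : _ + l = b.+1%:R * l); last by rewrite -natr1 mulrDl mul1r.
    by rewrite ler_pM2r // ler_nat.
  - by apply: ler_peMl; [exact: ltW|rewrite ler1n].
  - move=> i ip; rewrite aE // mulr_ge0 ?(ltW l0) //=.
    by rewrite ler_pM2r // ler_nat ltnW // stencil_index_lt.
rewrite Rintegral_panels //; last first.
  by move=> x; apply: cvgM; [exact: cX|exact: cY].
rewrite mulr_sumr -sumrB; apply: le_trans (ler_norm_sum _ _ _) _.
apply: le_trans (ler_sum _ (fun b _ => main b)) _.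
rewrite -mulr_sumr.
have SQ Z (b : 'I_B) : (S Z b + z) ^+ 2 <=
   2 * (p%:R * \sum_(i < p) Z ((stencil_index B q b i)%:R * l) ^+ 2) + 2 * z ^+ 2.
  have := sqr_sum_le (fun i : 'I_p => `|Z ((stencil_index B q b i)%:R * l)|).
  under [X in _ <= _ * X -> _]eq_bigr do rewrite real_normK ?num_real //.
  rewrite -/(S Z b) => H; have := sqr_ge0 (S Z b - z).
  by move: H; set Q := p%:R * _; lra.
have SQ2 Z : \sum_(b < B) (S Z b + z) ^+ 2 <=
   4 * p%:R ^+ 2 * \sum_(b < B) Z (b%:R * l) ^+ 2 + 2 * B%:R * z ^+ 2.
  apply: le_trans (ler_sum _ (fun b _ => SQ Z b)) _.
  rewrite big_split /= sumr_const card_ord -[_ *+ B]mulr_natl.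
  apply: lerD; last by apply: le_of_eq; ring.
  rewrite -!mulr_sumr exchange_big /=.
  apply: (@le_trans _ _ (2 * (p%:R * (p%:R * (2 * \sum_(b < B) Z (b%:R * l) ^+ 2))))).
    do 2 (apply: ler_wpM2l => //).
    apply: ler_sum_const => [|i _].
      by rewrite mulr_ge0 // sumr_ge0 // => b _; exact: sqr_ge0.
    apply: (sum_stencil_le (F := fun b => Z (b%:R * l) ^+ 2)) => // b.
    exact: sqr_ge0.
  by apply: le_of_eq; ring.
have PS : \sum_(b < B) (S X b + z) * (S Y b + z) <=
   2 * p%:R ^+ 2 * \sum_(b < B) (X (b%:R * l) ^+ 2 + Y (b%:R * l) ^+ 2) +
   2 * B%:R * z ^+ 2.
  apply: (@le_trans _ _ (\sum_(b < B) ((S X b + z) ^+ 2 / 2 + (S Y b + z) ^+ 2 / 2))).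
    apply: ler_sum => b _; have := sqr_ge0 ((S X b + z) - (S Y b + z)).
    by set u := S X b + z; set v := S Y b + z; lra.
  rewrite !big_split /= -!mulr_suml.
  by have := SQ2 X; have := SQ2 Y; lra.
have qp : 0 <= q%:R ^- p :> R by rewrite invr_ge0 exprn_ge0.
apply: (@le_trans _ _ (C * l * q%:R ^- p * (2 * p%:R ^+ 2 *
   \sum_(b < B) (X (b%:R * l) ^+ 2 + Y (b%:R * l) ^+ 2) + 2 * p%:R ^+ 2 * (B%:R * z ^+ 2)))).
  apply: ler_wpM2l; first by rewrite !mulr_ge0 // ltW.
  apply: le_trans PS _; rewrite lerD2l -subr_ge0.
  have -> : 2 * p%:R ^+ 2 * (B%:R * z ^+ 2) - 2 * B%:R * z ^+ 2 =
    2 * ((p%:R ^+ 2 - 1) * (B%:R * z ^+ 2)) by ring.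
  have p1 : 0 <= p%:R ^+ 2 - 1 :> R.
    by rewrite subr_ge0 -natrX ler1n expn_gt0; case/andP: hp => /ltnW ->.
  by rewrite mulr_ge0 // mulr_ge0 // mulr_ge0 // sqr_ge0.
by rewrite /T; apply: le_of_eq; ring.
Qed.

End Composite.

(** * The smallest singular value *)

Section SmallestSingularValue.
Context {R : realType}.
Variable n : nat.
Implicit Types (v w : 'rV[R]_n) (A B : 'M[R]_n).

Definition bform B v w : R := (v *m B *m w^T) 0 0.

Lemma bformDl B v v' w : bform B (v + v') w = bform B v w + bform B v' w.
Proof. by rewrite /bform !mulmxDl mxE. Qed.

Lemma bformZl B a v w : bform B (a *: v) w = a * bform B v w.
Proof. by rewrite /bform -!scalemxAl mxE. Qed.

Lemma bformDr B v w w' : bform B v (w + w') = bform B v w + bform B v w'.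
Proof. by rewrite /bform linearD /= mulmxDr mxE. Qed.

Lemma bformZr B a v w : bform B v (a *: w) = a * bform B v w.
Proof. by rewrite /bform linearZ /= -scalemxAr mxE. Qed.

Lemma bformC B v w : B^T = B -> bform B v w = bform B w v.
Proof.
move=> sB; rewrite /bform; transitivity ((v *m B *m w^T)^T 0 0); first by rewrite [RHS]mxE.
by rewrite !trmx_mul trmxK sB mulmxA.
Qed.

Lemma bform1E v : bform 1%:M v v = \sum_i v 0 i ^+ 2.
Proof. by rewrite /bform mulmx1 mxE; apply: eq_bigr => i _; rewrite mxE expr2. Qed.

Lemma bform1_ge0 v : 0 <= bform 1%:M v v.
Proof. by rewrite bform1E sumr_ge0 // => i _; rewrite sqr_ge0. Qed.

Lemma bform_gramE A v : bform (A^T *m A) v v = \sum_i (v *m A^T) 0 i ^+ 2.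
Proof.
rewrite /bform mulmxA -mulmxA (_ : A *m v^T = (v *m A^T)^T).
  by rewrite mxE; apply: eq_bigr => i _; rewrite [X in _ * X]mxE expr2.
by rewrite trmx_mul trmxK.
Qed.

Lemma bform_le B : exists2 K : R, 0 < K & forall v, bform B v v <= K * bform 1%:M v v.
Proof.
exists (1 + \sum_i \sum_j `|B i j|).
  by rewrite ltr_wpDr // sumr_ge0 // => i _; rewrite sumr_ge0.
move=> v; rewrite mulrDl mul1r; apply: ler_wpDl; first exact: bform1_ge0.
have -> : bform B v v = \sum_i \sum_j B i j * (v 0 i * v 0 j).
  rewrite /bform mxE exchange_big /=; apply: eq_bigr => j _.
  by rewrite !mxE mulr_suml; apply: eq_bigr => i _; ring.
rewrite mulr_suml; apply: ler_sum => i _; rewrite mulr_suml; apply: ler_sum => j _.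
have le k : v 0 k ^+ 2 <= bform 1%:M v v.
  by rewrite bform1E (bigD1 k) //= lerDl sumr_ge0 // => l _; rewrite sqr_ge0.
apply: le_trans (ler_norm _) _; rewrite normrM ler_wpM2l //.
have := le i; have := le j; have := sqr_ge0 (`|v 0 i| - `|v 0 j|).
rewrite normrM -[v 0 i ^+ 2]real_normK ?num_real // -[v 0 j ^+ 2]real_normK ?num_real //.
by set u := `|_|; set u' := `|_|; lra.
Qed.

(** With [w = v B^-1] the mixed term of the form at [v - t w] is the squared
    norm of [v]; its nonnegativity for a small [t] gives the gap. *)
Lemma psd_unitmx_gap B : B^T = B -> (forall v, 0 <= bform B v v) -> B \in unitmx ->
  exists2 c : R, 0 < c & forall v, c * bform 1%:M v v <= bform B v v.
Proof.
move=> sB pB uB; have [K K0 HK] := bform_le (invmx B).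
exists K^-1; first by rewrite invr_gt0.
move=> v; pose w := v *m invmx B.
have bvw : bform B v w = bform 1%:M v v.
  by rewrite bformC // /bform /w mulmxKV // mulmx1.
have bww : bform B w w = bform (invmx B) v v.
  by rewrite /bform {1}/w mulmxKV // /w trmx_mul trmx_inv sB mulmxA.
have := pB (v - K^-1 *: w).
rewrite -scaleNr !(bformDl, bformDr, bformZl, bformZr) (bformC w v sB) bvw bww.
have := HK v; set X := bform 1%:M v v; set Y := bform (invmx B) v v => YX.
have : K^-1 ^+ 2 * Y <= K^-1 * X.
  apply: le_trans (ler_wpM2l (exprn_ge0 2 _) YX) _; first by rewrite invr_ge0 ltW.
  by rewrite mulrA expr2 mulfVK ?gt_eqF.
lra.
Qed.

(** The infimum of the Rayleigh quotient of [A^T A] is an eigenvalue, for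
    otherwise the preceding gap would enlarge it; hence its square root is a
    singular value. *)
Lemma sigma_min_le A v : (0 < n)%N -> 0 <= sigma_min A ->
  sigma_min A ^+ 2 * \sum_i v 0 i ^+ 2 <= \sum_i (v *m A^T) 0 i ^+ 2.
Proof.
move=> n0 s0; rewrite -bform1E -bform_gramE; set S := A^T *m A.
have sS : S^T = S by rewrite trmx_mul trmxK.
have pS w : 0 <= bform S w w.
  by rewrite bform_gramE sumr_ge0 // => i _; rewrite sqr_ge0.
pose L : set R := [set c | 0 <= c /\ forall w, c * bform 1%:M w w <= bform S w w].
have L0 : L 0 by split=> // w; rewrite mul0r.
have ubL w : 0 < bform 1%:M w w -> ubound L (bform S w w / bform 1%:M w w).
  by move=> w0 c [_ Hc]; rewrite ler_pdivlMr.
have [K K0 HK] := bform_le S.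
have d1 : 0 < bform 1%:M (delta_mx 0 (Ordinal n0)) (delta_mx 0 (Ordinal n0)).
  rewrite bform1E (bigD1 (Ordinal n0)) //= !mxE !eqxx /= expr1n.
  by rewrite ltr_wpDr // sumr_ge0 // => i _; rewrite sqr_ge0.
have hubL : has_ubound L by eexists; exact: ubL d1.
pose m := sup L.
have m0 : 0 <= m by apply: ub_le_sup.
have mS w : m * bform 1%:M w w <= bform S w w.
  have [w0|w0] := ltP 0 (bform 1%:M w w); last first.
    have -> : bform 1%:M w w = 0 by apply/le_anti; rewrite w0 bform1_ge0.
    by rewrite mulr0.
  by rewrite -ler_pdivlMr //; apply: ge_sup; [exists 0|exact: ubL].
suff : sigma_min A ^+ 2 <= m.
  by move=> /ler_wpM2r => /(_ _ (bform1_ge0 v)) /le_trans; apply.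
pose B := S - m%:M.
have BE w : bform B w w = bform S w w - m * bform 1%:M w w.
  rewrite /bform /B mulmxBr mul_mx_scalar mulmxBl -scalemxAl mulmx1 [LHS]mxE.
  by congr (_ + _); rewrite [LHS]mxE [X in - X]mxE.
have nB : B \notin unitmx.
  apply/negP => uB.
  have [|w|c c0 Hc] := psd_unitmx_gap _ _ uB.
  - by rewrite /B linearB /= sS tr_scalar_mx.
  - by rewrite BE subr_ge0.
  have : L (m + c).
    split; first by rewrite addr_ge0 // ltW.
    by move=> w; have := Hc w; rewrite BE mulrDl lerBrDl.
  by move=> /(ub_le_sup hubL); rewrite -/m gerDl leNgt c0.
have ev : eigenvalue S m.
  rewrite /eigenvalue /eigenspace -/B; apply: contra nB => /eqP k0.
  by rewrite -row_free_unit -kermx_eq0 k0.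
have : sigma_min A <= Num.sqrt m.
  apply: ge_inf; first by exists 0 => x [].
  by split; rewrite ?sqrtr_ge0 // sqr_sqrtr.
by move=> H; rewrite -[m]sqr_sqrtr // lerXn2r // nnegrE ?sqrtr_ge0.
Qed.

(** [sigma_min_le] in the norms used below: passing from the Euclidean norm to
    the l^1 norm of [v] and to the largest entry of [A v] costs [sqrt n] each. *)
Lemma sigma_min_norm1 A v eta : (0 < n)%N -> 0 < sigma_min A ->
  (forall i, `|(v *m A^T) 0 i| <= eta) ->
  \sum_i `|v 0 i| <= n%:R * eta / sigma_min A.
Proof.
move=> n0 s0 Hv.
have e0 : 0 <= eta by apply: le_trans (Hv (Ordinal n0)).
have S0 : 0 <= \sum_i `|v 0 i| by apply: sumr_ge0.
rewrite ler_pdivlMr // -(@ler_pXn2r _ 2) ?nnegrE ?mulr_ge0 ?(ltW s0) // !exprMn.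
have := sqr_sum_le (fun i => `|v 0 i|).
under [X in _ <= _ * X -> _]eq_bigr do rewrite real_normK ?num_real //.
move=> /(ler_wpM2r (sqr_ge0 (sigma_min A))) /le_trans; apply.
rewrite -mulrA [X in _ * X]mulrC (expr2 n%:R) -mulrA ler_wpM2l //.
apply: le_trans (sigma_min_le v n0 (ltW s0)) _.
apply: ler_sum_const => [|i _]; first exact: sqr_ge0.
by rewrite -[X in X <= _]real_normK ?num_real // lerXn2r // nnegrE.
Qed.

End SmallestSingularValue.

(** * Means over the grid *)

Section DiscreteAverage.
Context {R : realType}.
Variable p : nat.
Hypothesis hp : (2 <= p <= 6)%N.
Local Notation P := (nc_degree p).

Lemma quad_weight_sum T N (F : nat -> R) : (P %| N)%N ->
  \sum_(i < N.+1) quad_weight p T i * F i =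
  T^-1 * (step T N * \sum_(b < N %/ P) \sum_(l < P.+1) nc_weight l * F (b * P + l)%N).
Proof.
move=> PN; rewrite /quad_weight.
under eq_bigr do rewrite -mulrA mulr_suml.
rewrite -mulr_sumr; congr (_ * _); rewrite exchange_big /= mulr_sumr.
apply: eq_bigr => b _; under eq_bigr do rewrite mulr_suml big_mkcond /=.
rewrite exchange_big mulr_sumr /=; apply: eq_bigr => l _.
have lt : (b * P + l < N.+1)%N.
  have := ltn_ord b; have := ltn_ord l; rewrite !ltnS => lP bN.
  rewrite (leq_trans (leq_add (leqnn _) lP)) // -mulSnr.
  by rewrite -[X in (_ <= X)%N](divnK PN) leq_mul2r bN orbT.
rewrite (bigD1 (Ordinal lt)) //= eqxx big1 ?addr0 ?mulrA // => i Hi.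
by rewrite ifF //; apply/negbTE; apply: contraNneq Hi => e; apply/eqP/val_inj.
Qed.

Lemma quad_weight_ge0 T N (i : 'I_N.+1) : 0 < T -> 0 <= quad_weight p T i :> R.
Proof.
move=> T0; have [_ Hw _] := @nc_weightsP R p hp.
apply: mulr_ge0; first by rewrite invr_ge0 ltW.
apply: sumr_ge0 => b _; apply: sumr_ge0 => l _; apply: mulr_ge0 => //.
by rewrite /step divr_ge0 // ltW.
Qed.

Lemma admissible_panels T N : admissible p N -> 0 < T ->
  [/\ (0 < N %/ P)%N, 0 < step T N :> R &
    T = (N %/ P)%:R * (P%:R * step T N)].
Proof.
move=> /andP[N0 PN] T0.
have P0 : (0 < P)%N := nc_degree_gt0 p.
split; first by rewrite divn_gt0 // dvdn_leq.
  by rewrite /step divr_gt0 // ltr0n.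
rewrite mulrA -natrM divnK // /step mulrC divfK //.
by rewrite pnatr_eq0 -lt0n.
Qed.

Lemma quad_weight_sum1 T N : 0 < T -> admissible p N ->
  \sum_(i < N.+1) quad_weight p T i = 1 :> R.
Proof.
move=> T0 aN; have [B0 h0 TE] := admissible_panels aN T0.
have := @quad_weight_sum T N (fun=> 1) (proj2 (andP aN)).
under eq_bigr do rewrite mulr1.
move=> ->; have [Hex _ _] := @nc_weightsP R p hp.
have W : \sum_(l < P.+1) nc_weight l * 1 = P%:R :> R.
  have := Hex 0%N; rewrite expr1 divr1 => <-; last by case/andP: hp => /ltnW.
  by apply: eq_bigr => l _; rewrite expr0.
under eq_bigr do rewrite W.
rewrite sumr_const card_ord -[_ *+ _]mulr_natl.
by rewrite [X in _ * X](_ : _ = T) ?mulVf ?gt_eqF // {2}TE; ring.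
Qed.

(** The first node of each panel has a weight bounded below, so the left end
    points of the panels carry a fixed share of the total weight. *)
Lemma panel_starts_le T N (F : nat -> R) : 0 < T -> admissible p N ->
  (forall i, 0 <= F i) ->
  P%:R * step T N * \sum_(b < N %/ P) F (b * P)%N <=
  4 * P%:R * T * \sum_(i < N.+1) quad_weight p T i * F i.
Proof.
move=> T0 aN F0; have [B0 h0 TE] := admissible_panels aN T0.
rewrite quad_weight_sum ?(proj2 (andP aN)) //.
have [_ Hw Hw0] := @nc_weightsP R p hp.
have le : \sum_(b < N %/ P) F (b * P)%N <=
    4 * \sum_(b < N %/ P) \sum_(l < P.+1) nc_weight l * F (b * P + l)%N.
  rewrite mulr_sumr; apply: ler_sum => b _.
  rewrite (bigD1 ord0) //= addn0.
  have : 0 <= \sum_(i < P.+1 | i != ord0) nc_weight i * F (b * P + i)%N.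
    by rewrite sumr_ge0 // => i _; rewrite mulr_ge0.
  have := F0 (b * P)%N; set f := F (b * P)%N => f0.
  have := ler_wpM2r f0 Hw0.
  by set u := nc_weight _ * _; lra.
apply: le_trans (ler_wpM2l _ le) _; first by rewrite mulr_ge0 // ltW.
apply: le_of_eq.
by set S := \sum_(b < _) _; field; rewrite gt_eqF.
Qed.

(** The functional behind the discrete inner product: a mean over the nodes, with
    the quadrature weights, and over the components. *)
Definition grid_mean M T N (E : 'I_N.+1 -> 'I_M -> R) : R :=
  M%:R^-1 * \sum_(i < N.+1) quad_weight p T i * \sum_(m < M) E i m.

Lemma innerNE M T N (g w : 'I_N.+1 -> 'rV[R]_M) :
  innerN p T g w = grid_mean T (fun i m => w i 0 m * g i 0 m).
Proof. by []. Qed.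

Lemma grid_meanD M T N (E E' : 'I_N.+1 -> 'I_M -> R) :
  grid_mean T (fun i m => E i m + E' i m) = grid_mean T E + grid_mean T E'.
Proof.
rewrite /grid_mean -mulrDr -big_split; congr (_ * _); apply: eq_bigr => i _ /=.
by rewrite big_split mulrDr.
Qed.

Lemma grid_meanZ M T N c (E : 'I_N.+1 -> 'I_M -> R) :
  grid_mean T (fun i m => c * E i m) = c * grid_mean T E.
Proof.
rewrite /grid_mean mulrCA; congr (_ * _); rewrite mulr_sumr; apply: eq_bigr => i _ /=.
by rewrite -mulr_sumr mulrCA.
Qed.

Lemma grid_mean_le M T N (E E' : 'I_N.+1 -> 'I_M -> R) : 0 < T ->
  (forall i m, E i m <= E' i m) -> grid_mean T E <= grid_mean T E'.
Proof.
move=> T0 H; apply: ler_wpM2l; first by rewrite invr_ge0.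
apply: ler_sum => i _; apply: ler_wpM2l; first exact: quad_weight_ge0.
by apply: ler_sum => m _; exact: H.
Qed.

Lemma grid_mean_cst M T N c : (0 < M)%N -> 0 < T -> admissible p N ->
  grid_mean T (fun (i : 'I_N.+1) (m : 'I_M) => c) = c.
Proof.
move=> M0 T0 aN; rewrite /grid_mean.
under eq_bigr do rewrite sumr_const card_ord.
rewrite -mulr_suml quad_weight_sum1 // mul1r -[c *+ M]mulr_natl mulrA mulVf ?mul1r //.
by rewrite pnatr_eq0 -lt0n.
Qed.

Lemma ler_norm_grid_mean M T N (E : 'I_N.+1 -> 'I_M -> R) : 0 < T ->
  `|grid_mean T E| <= grid_mean T (fun i m => `|E i m|).
Proof.
move=> T0; rewrite ler_norml; apply/andP; split; last first.
  by apply: grid_mean_le => // i m; exact: ler_norm.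
have H : grid_mean T (fun i m => -1 * `|E i m|) <= grid_mean T E.
  by apply: grid_mean_le => // i m; rewrite mulN1r lerNl -normrN ler_norm.
by move: H; rewrite grid_meanZ mulN1r.
Qed.

End DiscreteAverage.

(** * Errors on the inner products *)

Section InnerProducts.
Context {R : realType}.
Variable p : nat.
Hypothesis hp : (2 <= p <= 6)%N.
Local Notation P := (nc_degree p).
Local Notation mu := (@lebesgue_measure R).
Implicit Types (T L : R).

Definition grid_values M T N (X : R -> 'rV[R]_M) (i : 'I_N.+1) := X (i%:R * step T N).
Arguments grid_values {M} T N X i.

Definition smooth_path M T L (X : R -> 'rV[R]_M) := forall m,
  {within `[0, T], continuous (fun t => X t 0 m)} /\
  taylor_bounded p T L (fun t => X t 0 m).

Lemma innerN_ge0 M T N (X : 'I_N.+1 -> 'rV[R]_M) : 0 < T -> 0 <= innerN p T X X.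
Proof.
move=> T0; rewrite mulr_ge0 ?invr_ge0 // sumr_ge0 // => i _.
rewrite mulr_ge0 ?quad_weight_ge0 // sumr_ge0 // => m _.
by rewrite -expr2 sqr_ge0.
Qed.

(** The panels start at grid points, so the sums of squares left by the composite
    rule are at most a multiple of the discrete norms. *)
Lemma inner_quad_error : exists2 C : R, 0 <= C &
  forall T L M N q (X Y : R -> 'rV[R]_M), 0 < T -> 0 <= L -> (0 < M)%N ->
  admissible p N -> (0 < q)%N -> (2 * (p * q) <= N %/ P)%N ->
  smooth_path T L X -> smooth_path T L Y ->
  `|innerH T X Y - innerN p T (grid_values T N X) (grid_values T N Y)| <=
  C * q%:R ^- p *
    (innerN p T (grid_values T N X) (grid_values T N X) +
     innerN p T (grid_values T N Y) (grid_values T N Y) +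
     (L * (q%:R * (P%:R * step T N)) ^+ p) ^+ 2).
Proof.
have [C C0 HC] := @composite_product_error R p hp.
have P0 : (0 < P)%N := nc_degree_gt0 p.
exists (C * (4 * P%:R)); first by rewrite !mulr_ge0.
move=> T L M N q X Y T0 L0 M0 aN q0 qB tX tY.
have [B0 h0 TE] := admissible_panels aN T0.
set h := step T N in TE h0 *; set l := P%:R * h in TE *.
set z := L * _.
have M0' : M%:R != 0 :> R by rewrite pnatr_eq0 -lt0n.
have node b i : b%:R * l + i%:R * h = (b * P + i)%:R * h.
  by rewrite /l natrD natrM; ring.
have innE (U V : R -> 'rV[R]_M) :
  innerN p T (grid_values T N U) (grid_values T N V) = M%:R^-1 * \sum_(m < M)
    \sum_(i < N.+1) quad_weight p T i * (U (i%:R * h) 0 m * V (i%:R * h) 0 m).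
  rewrite /innerN; congr (_ * _); rewrite exchange_big /=; apply: eq_bigr => i _.
  by rewrite mulr_sumr; apply: eq_bigr => m _; rewrite [X in _ * X]mulrC.
have main m :
  `|\int[mu]_(t in `[0, T]) (X t 0 m * Y t 0 m) -
    T * \sum_(i < N.+1) quad_weight p T i * (X (i%:R * h) 0 m * Y (i%:R * h) 0 m)| <=
  C * q%:R ^- p * (4 * P%:R * T *
    (\sum_(i < N.+1) quad_weight p T i * (X (i%:R * h) 0 m * X (i%:R * h) 0 m) +
     \sum_(i < N.+1) quad_weight p T i * (Y (i%:R * h) 0 m * Y (i%:R * h) 0 m)) + T * z ^+ 2).
  have [cX bX] := tX m; have [cY bY] := tY m.
  have := HC (N %/ P)%N q h L (fun t => X t 0 m) (fun t => Y t 0 m) q0 qB h0 L0.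
  rewrite /= -/l -TE => /(_ cX cY bX bY).
  rewrite (quad_weight_sum _ (fun i => X (i%:R * h) 0 m * Y (i%:R * h) 0 m)) ?(proj2 (andP aN)) //.
  rewrite mulVKf ?gt_eqF // -/h.
  under [in X in X -> _]eq_bigr do under eq_bigr do rewrite node.
  move=> /le_trans; apply.
  apply: ler_wpM2l; first by rewrite mulr_ge0 // invr_ge0 exprn_ge0.
  rewrite lerD2r -big_split /=.
  have := @panel_starts_le R p hp T N
    (fun i => X (i%:R * h) 0 m ^+ 2 + Y (i%:R * h) 0 m ^+ 2) T0 aN _.
  rewrite -/h -/l => le.
  apply: (@le_trans _ _ (l * \sum_(b < N %/ P)
    (X ((b * P)%N%:R * h) 0 m ^+ 2 + Y ((b * P)%N%:R * h) 0 m ^+ 2))).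
    apply: le_of_eq; congr (_ * _).
    by apply: eq_bigr => b _; rewrite /l natrM mulrA.
  apply: le_trans (le _) _; first by move=> i; rewrite addr_ge0 ?sqr_ge0.
  apply: le_of_eq; congr (_ * _).
  by apply: eq_bigr => i _; rewrite -mulrDr !expr2.
rewrite /innerH !innE.
have MT : (M%:R * T)^-1 = M%:R^-1 * T^-1 :> R by rewrite invfM.
rewrite (_ : _ - _ = (M%:R * T)^-1 * \sum_(m < M)
   (\int[mu]_(t in `[0, T]) (X t 0 m * Y t 0 m) -
    T * \sum_(i < N.+1) quad_weight p T i * (X (i%:R * h) 0 m * Y (i%:R * h) 0 m))); last first.
  rewrite sumrB -mulr_sumr mulrBr; congr (_ - _).
  by rewrite MT -mulrA mulKf // gt_eqF.
have MT0 : 0 < (M%:R * T)^-1 by rewrite invr_gt0 mulr_gt0 // ltr0n.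
rewrite normrM (gtr0_norm MT0).
apply: le_trans (ler_wpM2l (ltW MT0) (ler_norm_sum _ _ _)) _.
apply: le_trans (ler_wpM2l (ltW MT0) (ler_sum _ (fun m _ => main m))) _.
rewrite -mulr_sumr big_split /= -mulr_sumr big_split /= sumr_const card_ord.
rewrite -[T * _ *+ M]mulr_natl.
set SX := \sum_(m < M) _; set SY := \sum_(m < M) _; set QQ := q%:R ^- p.
have QQ0 : 0 <= QQ by rewrite invr_ge0 exprn_ge0.
apply: (@le_trans _ _ (C * QQ * (4 * P%:R * (M%:R^-1 * SX + M%:R^-1 * SY) + z ^+ 2))).
  by apply: le_of_eq; field; rewrite M0' gt_eqF.
rewrite [leRHS](_ : _ = C * QQ * (4 * P%:R * (M%:R^-1 * SX + M%:R^-1 * SY + z ^+ 2))); last by ring.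
apply: ler_wpM2l; first exact: mulr_ge0.
rewrite -subr_ge0 (_ : _ - _ = (4 * P%:R - 1) * z ^+ 2); last by ring.
rewrite mulr_ge0 ?sqr_ge0 // subr_ge0 -natrM ler1n.
by rewrite muln_gt0.
Qed.

End InnerProducts.

Arguments grid_values {R M} T N X i.

Section InnerError.
Context {R : realType}.
Variable p : nat.
Hypothesis hp : (2 <= p <= 6)%N.
Local Notation P := (nc_degree p).
Local Notation mu := (@lebesgue_measure R).
Implicit Types (T L m h eps : R).

(** The spacing of the stencil is the largest multiple of the panel length whose
    [p]-th power is at most [lam]; the next multiple is at most twice as large
    and exceeds [lam], hence the second bound. *)
Lemma exists_stencil_width T N lam : 0 < T -> admissible p N ->
  (P%:R * step T N) ^+ p <= lam -> lam <= (T / (2 * p%:R)) ^+ p ->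
  exists2 q : nat, (0 < q)%N /\ (2 * (p * q) <= N %/ P)%N &
    (q%:R * (P%:R * step T N)) ^+ p <= lam /\
    q%:R ^- p * lam <= (2 * (P%:R * step T N)) ^+ p.
Proof.
move=> T0 aN hlam lamT; have [B0 h0 TE] := admissible_panels aN T0.
have P0 : (0 < P)%N := nc_degree_gt0 p.
have p0 : (0 < p)%N by case/andP: hp => /ltnW.
have l0 : 0 < P%:R * step T N by rewrite mulr_gt0 // ltr0n.
set l := P%:R * step T N in l0 hlam TE *.
pose ok q := (q%:R * l) ^+ p <= lam.
have ok1 : ok 1%N by rewrite /ok mul1r.
have ub q : ok q -> (2 * (p * q) <= N %/ P)%N.
  have tp : 0 < 2 * p%:R :> R by rewrite mulr_gt0 // ltr0n.
  move=> /le_trans /(_ lamT).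
  rewrite ler_pXn2r // ?nnegrE ?divr_ge0 ?mulr_ge0 ?(ltW l0) ?(ltW T0) //.
  rewrite ler_pdivlMr // [leRHS]TE [leLHS](_ : _ = (2 * (p * q))%N%:R * l).
    by rewrite ler_pM2r // ler_nat.
  by rewrite !natrM; ring.
have ub' q : ok q -> (q <= N %/ P)%N.
  by move=> /ub; apply: leq_trans; rewrite mulnA leq_pmull // muln_gt0.
have [q okq qmax] := ex_maxnP (ex_intro _ 1%N ok1) ub'.
have q0 : (0 < q)%N by exact: qmax ok1.
have q0' : 0 < q%:R :> R by rewrite ltr0n.
exists q; split=> //; first exact: ub.
have nok : lam <= (q.+1%:R * l) ^+ p.
  by rewrite leNgt; apply/negP => /ltW /qmax; rewrite ltnn.
rewrite mulrC ler_pdivrMr ?exprn_gt0 // -exprMn.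
have nq : q.+1%:R * l <= 2 * l * q%:R.
  by rewrite mulrAC ler_pM2r // -natrM ler_nat mul2n -addnn -addn1 leq_add2l.
apply: le_trans nok _; apply: lerXn2r => //; rewrite nnegrE.
  by rewrite mulr_ge0 // ltW.
by rewrite !mulr_ge0 // ltW.
Qed.

Lemma inner_perturbation T M N m eps (X Y x y : 'I_N.+1 -> 'rV[R]_M) :
  0 < T -> (0 < M)%N -> admissible p N -> 0 < m -> eps <= m ->
  (forall i k, `|X i 0 k - x i 0 k| <= eps) -> (forall i k, `|Y i 0 k - y i 0 k| <= eps) ->
  innerN p T x x <= 4 * m ^+ 2 -> innerN p T y y <= 4 * m ^+ 2 ->
  `|innerN p T X Y - innerN p T x y| <= 5 * eps * m.
Proof.
move=> T0 M0 aN m0 em HX HY Hx Hy.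
have i0 : 'I_N.+1 := ord0.
have e0 : 0 <= eps by apply: le_trans (HX i0 (Ordinal M0)).
have -> : innerN p T X Y - innerN p T x y =
   grid_mean p T (fun i k => Y i 0 k * X i 0 k + (-1) * (y i 0 k * x i 0 k)).
  by rewrite grid_meanD grid_meanZ mulN1r.
apply: le_trans (ler_norm_grid_mean hp _ T0) _.
pose c := eps / (4 * m).
have c0 : 0 <= c by rewrite divr_ge0 // mulr_ge0 // ltW.
apply: (@le_trans _ _ (grid_mean p T (fun (i : 'I_N.+1) (k : 'I_M) =>
   (c * (x i 0 k * x i 0 k) + c * (y i 0 k * y i 0 k)) + 3 * eps * m))).
  apply: grid_mean_le => // i k.
  have -> : Y i 0 k * X i 0 k + -1 * (y i 0 k * x i 0 k) =
    (X i 0 k - x i 0 k) * (Y i 0 k - y i 0 k) + (X i 0 k - x i 0 k) * y i 0 k +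
    x i 0 k * (Y i 0 k - y i 0 k) by ring.
  have H1 : `|(X i 0 k - x i 0 k) * (Y i 0 k - y i 0 k)| <= eps * m.
    by rewrite normrM; apply: ler_pM => //; apply: le_trans (HY _ _) em.
  have H2 : `|(X i 0 k - x i 0 k) * y i 0 k| <= c * (y i 0 k * y i 0 k) + eps * m.
    rewrite normrM; apply: le_trans (ler_pM _ _ (HX i k) (abs_le_sqr _ m0)) _ => //.
    by apply: le_of_eq; rewrite /c; ring.
  have H3 : `|x i 0 k * (Y i 0 k - y i 0 k)| <= c * (x i 0 k * x i 0 k) + eps * m.
    rewrite normrM mulrC; apply: le_trans (ler_pM _ _ (HY i k) (abs_le_sqr _ m0)) _ => //.
    by apply: le_of_eq; rewrite /c; ring.
  apply: le_trans (ler_normD _ _) _; apply: le_trans (lerD (ler_normD _ _) (lexx _)) _.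
  by lra.
rewrite !grid_meanD !grid_meanZ grid_mean_cst // -!innerNE.
have H z : z <= 4 * m ^+ 2 -> c * z <= eps * m.
  move=> /(ler_wpM2l c0) /le_trans; apply.
  by apply: le_of_eq; rewrite /c; field; rewrite gt_eqF.
by have := H _ Hx; have := H _ Hy; lra.
Qed.

Lemma innerN_perturbed_le T M N m eps (X x : 'I_N.+1 -> 'rV[R]_M) :
  0 < T -> (0 < M)%N -> admissible p N -> 0 < m -> eps <= m ->
  (forall i k, `|X i 0 k - x i 0 k| <= eps) ->
  innerN p T x x <= 4 * m ^+ 2 -> innerN p T X X <= 10 * m ^+ 2.
Proof.
move=> T0 M0 aN m0 em HX Hx.
have e0 : 0 <= eps by apply: le_trans (HX ord0 (Ordinal M0)).
apply: (@le_trans _ _ (grid_mean p T (fun (i : 'I_N.+1) (k : 'I_M) =>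
   2 * (x i 0 k * x i 0 k) + 2 * m ^+ 2))).
  rewrite innerNE; apply: grid_mean_le => // i k.
  have H : (X i 0 k - x i 0 k) ^+ 2 <= m ^+ 2.
    rewrite -[_ ^+ 2]real_normK ?num_real // lerXn2r ?nnegrE ?(ltW m0) //.
    exact: le_trans (HX i k) em.
  have := sqr_ge0 (X i 0 k - 2 * x i 0 k).
  by move: H; set a := X i 0 k; set b := x i 0 k; lra.
by rewrite grid_meanD grid_meanZ grid_mean_cst // -innerNE; lra.
Qed.

(** The [p]-th power of the largest spacing for which the stencils fit in half of
    the interval. *)
Definition quad_scale (T : R) := (T / (2 * p%:R)) ^+ p.

(** The quadrature error is at most a multiple of
    [q ^ -p * (m ^ 2 + L ^ 2 * lam ^ 2)], where [lam] is about
    [(q * P * h) ^ p].  The choice [lam = quad_scale T * (m / L)] balances the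
    two terms and leaves [L * m * h ^ p]: one factor [m] survives. *)
Lemma inner_error : exists2 C : R -> R -> R, (forall T L, 0 < T -> 0 < L -> 0 <= C T L) &
  forall T L M N m eps (X Y : R -> 'rV[R]_M) (x y : 'I_N.+1 -> 'rV[R]_M),
  0 < T -> (0 < M)%N -> admissible p N -> 0 < m -> m <= L -> eps <= m ->
  (P%:R * step T N) ^+ p <= quad_scale T * (m / L) ->
  smooth_path p T L X -> smooth_path p T L Y ->
  (forall i k, `|grid_values T N X i 0 k - x i 0 k| <= eps) ->
  (forall i k, `|grid_values T N Y i 0 k - y i 0 k| <= eps) ->
  innerN p T x x <= 4 * m ^+ 2 -> innerN p T y y <= 4 * m ^+ 2 ->
  `|innerH T X Y - innerN p T x y| <= C T L * m * step T N ^+ p + 5 * eps * m.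
Proof.
have [C C0 HC] := @inner_quad_error R p hp.
have P0 : (0 < P)%N := nc_degree_gt0 p.
have p0 : (0 < p)%N by case/andP: hp => /ltnW.
have ks0 T : 0 < T -> 0 < quad_scale T.
  by move=> T0; rewrite exprn_gt0 // divr_gt0 // mulr_gt0 // ltr0n.
exists (fun T L => C * ((2 * P%:R) ^+ p / quad_scale T * (20 + quad_scale T ^+ 2) * L)).
  move=> T L T0 L0; rewrite mulr_ge0 // mulr_ge0 ?(ltW L0) // mulr_ge0 //.
    by rewrite divr_ge0 ?exprn_ge0 ?mulr_ge0 // ltW ?ks0.
  by rewrite addr_ge0 // sqr_ge0.
move=> T L M N m eps X Y x y T0 M0 aN m0 mL em hsmall tX tY HX HY Hx Hy.
have L0 : 0 < L by apply: lt_le_trans mL.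
have k0 := ks0 T T0; set kap := quad_scale T in k0 hsmall *.
have lam0 : 0 < kap * (m / L) by rewrite mulr_gt0 // divr_gt0.
have lamle : kap * (m / L) <= kap.
  by rewrite ger_pMr // ler_pdivrMr // mul1r.
have [q [q0 qB] [ql qi]] := exists_stencil_width T0 aN hsmall lamle.
have gX := innerN_perturbed_le T0 M0 aN m0 em HX Hx.
have gY := innerN_perturbed_le T0 M0 aN m0 em HY Hy.
have B1 := HC T L M N q X Y T0 (ltW L0) M0 aN q0 qB tX tY.
have B2 := inner_perturbation T0 M0 aN m0 em HX HY Hx Hy.
rewrite (_ : _ - _ = (innerH T X Y - innerN p T (grid_values T N X) (grid_values T N Y)) +
  (innerN p T (grid_values T N X) (grid_values T N Y) - innerN p T x y)); last by ring.
apply: le_trans (ler_normD _ _) _; apply: lerD => //.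
apply: le_trans B1 _.
have Q0 : 0 <= q%:R ^- p :> R by rewrite invr_ge0 exprn_ge0.
have L2 : (L * (q%:R * (P%:R * step T N)) ^+ p) ^+ 2 <= (kap * m) ^+ 2.
  have [_ h0 _] := admissible_panels aN T0.
  have z0 : 0 <= L * (q%:R * (P%:R * step T N)) ^+ p.
    by rewrite mulr_ge0 ?(ltW L0) // exprn_ge0 // !mulr_ge0 // ltW.
  apply: lerXn2r => //; first by rewrite nnegrE mulr_ge0 // ltW.
  apply: le_trans (ler_wpM2l (ltW L0) ql) _.
  by apply: le_of_eq; field; rewrite gt_eqF.
set W := (20 + kap ^+ 2) * (m * (L / kap)).
have W0 : 0 <= W.
  rewrite mulr_ge0 ?addr_ge0 ?sqr_ge0 // mulr_ge0 ?(ltW m0) //.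
  by rewrite divr_ge0 // ltW.
apply: (@le_trans _ _ (C * (q%:R ^- p * (kap * (m / L)) * W))).
  rewrite -mulrA; apply: ler_wpM2l => //.
  have -> : q%:R ^- p * (kap * (m / L)) * W = q%:R ^- p * ((20 + kap ^+ 2) * m ^+ 2).
    by rewrite /W; field; rewrite !gt_eqF // exprn_gt0 // ltr0n.
  by apply: ler_wpM2l => //; move: gX gY L2; rewrite exprMn; lra.
apply: le_trans (ler_wpM2l C0 (ler_wpM2r W0 qi)) _.
by rewrite /W !exprMn; apply: le_of_eq; ring.
Qed.

End InnerError.

(** * Perturbation of the normal equations *)

Section CoefficientBounds.
Context {R : realType}.
Variable n : nat.

(** The test vector [e_0] in [sigma_min_norm1]. *)
Lemma sigma_min_le_entries (G : 'M[R]_n) (c : R) : (0 < n)%N -> 0 < sigma_min G ->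
  (forall a b, `|G a b| <= c) -> sigma_min G <= n%:R * c.
Proof.
move=> n0 s0 HG; pose i0 := Ordinal n0.
have := @sigma_min_norm1 R n G (delta_mx 0 i0) c n0 s0 _.
rewrite (bigD1 i0) //= mxE !eqxx normr1 big1 ?addr0; last first.
  by move=> i /negbTE Hi; rewrite mxE Hi andbF normr0.
rewrite ler_pdivlMr // mul1r; apply => a.
rewrite -rowE !mxE; exact: HG.
Qed.

(** The vector [v1] solves the system of matrix [G] and right-hand side
    [f1 + (G - G1) v1], and [v - v1] that of right-hand side
    [f - f1 - (G - G1) v1]; the smallness of [delta] absorbs the last term of the
    first one. *)
Lemma normal_equations_perturbation (G G1 : 'M[R]_n) (v v1 : 'rV[R]_n)
    (f f1 : 'I_n -> R) (U2 delta : R) : (0 < n)%N -> 0 < sigma_min G ->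
  (forall a, \sum_q v 0 q * G a q = f a) ->
  (forall a, \sum_q v1 0 q * G1 a q = f1 a) ->
  (forall a b, `|G a b - G1 a b| <= delta) -> (forall a, `|f a - f1 a| <= delta) ->
  (forall a, `|f1 a| <= U2) -> (forall a b, `|G a b| <= U2) ->
  n%:R * delta <= sigma_min G / 2 ->
  \sum_q `|v1 0 q| <= 2 * (U2 * n%:R / sigma_min G) /\
  \sum_q `|(v - v1) 0 q| <= 3 * delta * (U2 * n%:R ^+ 2 / sigma_min G ^+ 2).
Proof.
move=> n0 s0 Hv Hv1 HG Hf Hf1 HU hd; set s := sigma_min G in s0 hd *.
have n0' : 0 < n%:R :> R by rewrite ltr0n.
have d0 : 0 <= delta by apply: le_trans (Hf (Ordinal n0)).
have U0 : 0 <= U2 by apply: le_trans (Hf1 (Ordinal n0)).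
have mulE (x : 'rV[R]_n) a : (x *m G^T) 0 a = \sum_q x 0 q * G a q.
  by rewrite mxE; apply: eq_bigr => q _; rewrite mxE.
set S1 := \sum_q `|v1 0 q|.
have S10 : 0 <= S1 by apply: sumr_ge0.
have dG a : `|\sum_q v1 0 q * (G a q - G1 a q)| <= delta * S1.
  apply: le_trans (ler_norm_sum _ _ _) _; rewrite mulr_sumr; apply: ler_sum => q _.
  by rewrite normrM mulrC ler_wpM2r.
have B1 : S1 <= 2 * (U2 * n%:R / s).
  have H : S1 <= n%:R * (U2 + delta * S1) / s.
    apply: sigma_min_norm1 => // a; rewrite mulE.
    have -> : \sum_q v1 0 q * G a q = f1 a + \sum_q v1 0 q * (G a q - G1 a q).
      by rewrite -Hv1 -big_split; apply: eq_bigr => q _ /=; ring.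
    by apply: le_trans (ler_normD _ _) (lerD _ _).
  have {}H : S1 * s <= n%:R * (U2 + delta * S1) by rewrite -ler_pdivlMr.
  have E := ler_wpM2r S10 hd.
  rewrite mulrA ler_pdivlMr //.
  by move: H E; rewrite mulrDr; set A := n%:R * U2; rewrite (mulrA n%:R delta S1);
     rewrite (mulrC U2); rewrite -/A; lra.
split=> //.
have sU : s <= n%:R * U2 by exact: sigma_min_le_entries.
have H : \sum_q `|(v - v1) 0 q| <= n%:R * (delta + delta * S1) / s.
  apply: sigma_min_norm1 => // a; rewrite mulE.
  have -> : \sum_q (v - v1) 0 q * G a q =
      (f a - f1 a) + - \sum_q v1 0 q * (G a q - G1 a q).
    rewrite -Hv -Hv1 -sumrB -sumrN -big_split; apply: eq_bigr => q _ /=.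
    by rewrite !mxE; ring.
  by apply: le_trans (ler_normD _ _) (lerD _ _); rewrite ?normrN.
apply: le_trans H _.
have T1 : 1 <= U2 * n%:R / s by rewrite ler_pdivlMr // mul1r mulrC.
have -> : 3 * delta * (U2 * n%:R ^+ 2 / s ^+ 2) = n%:R * (delta * (3 * (U2 * n%:R / s))) / s.
  by field; rewrite gt_eqF.
apply: ler_wpM2r; first by rewrite invr_ge0 ltW.
apply: ler_wpM2l; first exact: ltW.
rewrite -[X in X + _]mulr1 -mulrDr; apply: ler_wpM2l => //; lra.
Qed.

End CoefficientBounds.

(** * Normal equations of the two projections *)

Section Projections.
Context {R : realType}.
Variable p : nat.
Hypothesis hp : (2 <= p <= 6)%N.
Local Notation mu := (@lebesgue_measure R).
Implicit Types (T L c : R).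

Definition cont_path M T (X : R -> 'rV[R]_M) :=
  forall m, {within `[0, T], continuous (fun t => X t 0 m)}.

Lemma innerH_sub_lincomb M T n (X Y : R -> 'rV[R]_M) (E : 'I_n -> R -> 'rV[R]_M)
    (c : 'I_n -> R) : cont_path T X -> cont_path T Y -> (forall q, cont_path T (E q)) ->
  innerH T (fun t => X t - \sum_(q < n) c q *: E q t) Y =
  innerH T X Y - \sum_(q < n) c q * innerH T (E q) Y.
Proof.
move=> cX cY cE; rewrite /innerH.
under [X in _ = _ - X]eq_bigr do rewrite mulrCA.
rewrite -mulr_sumr -mulrBr; congr (_ * _).
under [X in _ = _ - X]eq_bigr do rewrite mulr_sumr.
rewrite exchange_big -sumrB; apply: eq_bigr => m _ /=.
have cEY q : {within `[0, T], continuous (fun t => E q t 0 m * Y t 0 m)}.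
  by move=> t; apply: cvgM; [exact: cE|exact: cY].
have cXY : {within `[0, T], continuous (fun t => X t 0 m * Y t 0 m)}.
  by move=> t; apply: cvgM; [exact: cX|exact: cY].
rewrite -Rintegral_lincomb // -RintegralB //.
- apply: eq_Rintegral => t _; rewrite !mxE mulrBl; congr (_ - _).
  by rewrite summxE mulr_suml; apply: eq_bigr => q _; rewrite mxE mulrA.
- exact: segment_integrable.
- by apply: segment_integrable; exact: continuous_within_lincomb.
Qed.

Lemma orth_proj_normal_equations M T n (e : 'I_n -> R -> 'rV[R]_M) X w :
  cont_path T X -> (forall q, cont_path T (e q)) -> is_orth_proj T e X w ->
  exists2 v : 'rV[R]_n, (forall t, t \in `[0, T] -> w t = \sum_(q < n) v 0 q *: e q t) &
    forall a, \sum_q v 0 q * gramH T e a q = innerH T X (e a).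
Proof.
move=> cX ce [[c Hc] Ho]; exists (\row_q c q).
  by move=> t /Hc ->; apply: eq_bigr => q _; rewrite mxE.
move=> a; have : in_span T e (e a).
  exists (fun q => (q == a)%:R) => t _.
  by rewrite (bigD1 a) //= eqxx scale1r big1 ?addr0 // => i /negbTE ->; rewrite scale0r.
move=> /Ho.
have -> : innerH T (fun t => X t - w t) (e a) =
   innerH T (fun t => X t - \sum_(q < n) c q *: e q t) (e a).
  rewrite /innerH; congr (_ * _); apply: eq_bigr => m _; apply: eq_Rintegral => t.
  by rewrite inE => /Hc ->.
rewrite innerH_sub_lincomb // => /eqP; rewrite subr_eq0 => /eqP ->.
by apply: eq_bigr => q _; rewrite !mxE.
Qed.

Lemma innerH_le_cst M T c (X Y : R -> 'rV[R]_M) : 0 < T -> (0 < M)%N -> 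
  cont_path T X -> cont_path T Y ->
  (forall t m, 0 <= t <= T -> `|X t 0 m * Y t 0 m| <= c) -> `|innerH T X Y| <= c.
Proof.
move=> T0 M0 cX cY H.
have MT : 0 < (M%:R * T)^-1 by rewrite invr_gt0 mulr_gt0 // ltr0n.
rewrite /innerH normrM (gtr0_norm MT) mulrC ler_pdivrMr ?invr_gt0 // ?mulr_gt0 ?ltr0n //.
have -> : c * (M%:R * T) = \sum_(m < M) (c * T).
  by rewrite sumr_const card_ord -mulr_natl; ring.
apply: le_trans (ler_norm_sum _ _ _) _; apply: ler_sum => m _.
have cXY : {within `[0, T], continuous (fun t => X t 0 m * Y t 0 m)}.
  by move=> t; apply: cvgM; [exact: cX|exact: cY].
apply: le_trans (le_normr_Rintegral _ (segment_integrable cXY)) _ => //.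
have -> : c * T = \int[mu]_(t in `[0, T]) c by rewrite Rintegral_itv_cst ?subr0 // ltW.
apply: le_Rintegral => //.
- apply: segment_integrable => t; apply: cvg_norm; exact: cXY.
- by apply: segment_integrable; apply: continuous_subspaceT => x; exact: cvg_cst.
- by move=> t; rewrite /= in_itv /= => tT; exact: H.
Qed.

Lemma innerH_ge0 M T (X : R -> 'rV[R]_M) : 0 < T -> 0 <= innerH T X X.
Proof.
move=> T0; rewrite mulr_ge0 // ?invr_ge0 ?mulr_ge0 ?(ltW T0) // sumr_ge0 // => m _.
by apply: Rintegral_ge0 => t _; rewrite -expr2 sqr_ge0.
Qed.

Lemma innerH_le_norm M T U (X Y : R -> 'rV[R]_M) : 0 < T -> cont_path T X -> cont_path T Y ->
  normH T X <= U -> normH T Y <= U -> `|innerH T X Y| <= U ^+ 2.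
Proof.
move=> T0 cX cY.
have sq Z : normH T Z <= U -> innerH T Z Z <= U ^+ 2.
  move=> H; rewrite -[innerH T Z Z]sqr_sqrtr ?innerH_ge0 // lerXn2r ?nnegrE ?sqrtr_ge0 //.
  by apply: le_trans H; exact: sqrtr_ge0.
move=> /sq HX /sq HY.
have main : `|innerH T X Y| <= (innerH T X X + innerH T Y Y) / 2.
  have MT : 0 <= (M%:R * T)^-1 by rewrite invr_ge0 mulr_ge0 // ltW.
  rewrite /innerH normrM (ger0_norm MT) -mulrDr -mulrA; apply: ler_wpM2l => //.
  apply: le_trans (ler_norm_sum _ _ _) _; rewrite -big_split /= mulr_suml.
  apply: ler_sum => m _.
  have cc (V W : R -> 'rV[R]_M) : cont_path T V -> cont_path T W ->
     {within `[0, T], continuous (fun t => V t 0 m * W t 0 m)}.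
    by move=> cV cW t; apply: cvgM; [exact: cV|exact: cW].
  have cXY := cc _ _ cX cY; have cXX := cc _ _ cX cX; have cYY := cc _ _ cY cY.
  apply: le_trans (le_normr_Rintegral _ (segment_integrable cXY)) _ => //.
  rewrite -RintegralD //; [|exact: segment_integrable..].
  have cS : {within `[0, T], continuous (fun t => X t 0 m * X t 0 m + Y t 0 m * Y t 0 m)}.
    by move=> t; apply: cvgD; [exact: cXX|exact: cYY].
  rewrite -RintegralZr //; last exact: segment_integrable.
  apply: le_Rintegral => //.
  - apply: segment_integrable => t; apply: cvg_norm; exact: cXY.
  - by apply: segment_integrable => t; apply: cvgM; [exact: cS|exact: cvg_cst].
  - move=> t _; rewrite normrM; have := sqr_ge0 (`|X t 0 m| - `|Y t 0 m|).
    rewrite -[X t 0 m * _]expr2 -[Y t 0 m * _]expr2.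
    rewrite -[X t 0 m ^+ 2]real_normK ?num_real // -[Y t 0 m ^+ 2]real_normK ?num_real //.
    by lra.
by apply: le_trans main _; lra.
Qed.

Lemma innerN_sub_lincomb M T N n (x y : 'I_N.+1 -> 'rV[R]_M)
    (e : 'I_n -> 'I_N.+1 -> 'rV[R]_M) (c : 'I_n -> R) :
  innerN p T (fun i => x i - \sum_(q < n) c q *: e q i) y =
  innerN p T x y - \sum_(q < n) c q * innerN p T (e q) y.
Proof.
elim: n e c => [|n IH] e c.
  by rewrite big_ord0 subr0; congr innerN; apply/funext => i; rewrite big_ord0 subr0.
rewrite big_ord_recr /= opprD addrA -(IH (fun q => e (widen_ord (leqnSn n) q))).
rewrite !innerNE -mulN1r -!grid_meanZ -grid_meanD; congr grid_mean.
apply/funext => i; apply/funext => m; rewrite big_ord_recr /= !mxE; ring.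
Qed.

Lemma innerN_le_norm M T N U (x y : 'I_N.+1 -> 'rV[R]_M) : 0 < T ->
  normN p T x <= U -> normN p T y <= U -> `|innerN p T x y| <= U ^+ 2.
Proof.
move=> T0.
have sq z : normN p T z <= U -> innerN p T z z <= U ^+ 2.
  move=> H; rewrite -[innerN p T z z]sqr_sqrtr ?(innerN_ge0 hp) // lerXn2r ?nnegrE ?sqrtr_ge0 //.
  by apply: le_trans H; exact: sqrtr_ge0.
move=> /sq Hx /sq Hy; rewrite innerNE.
apply: le_trans (ler_norm_grid_mean hp _ T0) _.
apply: (@le_trans _ _ (grid_mean p T (fun (i : 'I_N.+1) (k : 'I_M) =>
   2^-1 * (x i 0 k * x i 0 k) + 2^-1 * (y i 0 k * y i 0 k)))).
  apply: grid_mean_le => // i m; rewrite normrM.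
  have := sqr_ge0 (`|x i 0 m| - `|y i 0 m|).
  rewrite -[x i 0 m * _]expr2 -[y i 0 m * _]expr2.
  rewrite -[x i 0 m ^+ 2]real_normK ?num_real // -[y i 0 m ^+ 2]real_normK ?num_real //.
  by lra.
by rewrite grid_meanD !grid_meanZ -!innerNE; lra.
Qed.

(** The residual is orthogonal to [e a]: otherwise a small step along [e a]
    decreases its norm. *)
Lemma least_squares_normal_equations M T N n (e : 'I_n -> 'I_N.+1 -> 'rV[R]_M)
    (x : 'I_N.+1 -> 'rV[R]_M) (v : 'rV[R]_n) : 0 < T -> is_least_squares p T e x v ->
  forall a, \sum_q v 0 q * innerN p T (e q) (e a) = innerN p T x (e a).
Proof.
move=> T0 Hv a.
pose r i := x i - \sum_(q < n) v 0 q *: e q i.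
suff : innerN p T r (e a) = 0.
  by rewrite innerN_sub_lincomb => /eqP; rewrite subr_eq0 => /eqP ->.
set b := innerN p T r (e a); set g := innerN p T (e a) (e a).
have g0 : 0 <= g := innerN_ge0 hp _ T0.
have quad s : 2 * s * b <= s ^+ 2 * g.
  have := Hv (v + s *: delta_mx 0 a); rewrite -/r.
  have -> : (fun i => x i - \sum_(q < n) (v + s *: delta_mx 0 a) 0 q *: e q i) =
     (fun i => r i - s *: e a i).
    apply/funext => i; rewrite /r -addrA -opprD; congr (_ - _).
    under eq_bigr do rewrite !mxE scalerDl.
    rewrite big_split /=; congr (_ + _).
    rewrite (bigD1 a) //= !eqxx mulr1 big1 ?addr0 // => q /negbTE ->.
    by rewrite ?andbF mulr0 scale0r.
  rewrite ler_sqrt ?(innerN_ge0 hp) //.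
  have -> : innerN p T (fun i => r i - s *: e a i) (fun i => r i - s *: e a i) =
     innerN p T r r + (- (2 * s) * b + s ^+ 2 * g).
    rewrite /b /g !innerNE -!grid_meanZ -!grid_meanD; congr grid_mean.
    by apply/funext => i; apply/funext => m; rewrite !mxE; ring.
  by rewrite lerDl mulNr addrC subr_ge0.
have g1 : 0 < g + 1 by rewrite ltr_wpDl.
have := quad (b / (g + 1)).
have -> : 2 * (b / (g + 1)) * b = b ^+ 2 / (g + 1) ^+ 2 * (2 * (g + 1)).
  by field; rewrite gt_eqF.
have -> : (b / (g + 1)) ^+ 2 * g = b ^+ 2 / (g + 1) ^+ 2 * g by rewrite expr_div_n.
rewrite -subr_ge0 -mulrBr => H.
have H2 : 0 <= b ^+ 2 / (g + 1) ^+ 2 by rewrite divr_ge0 ?sqr_ge0.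
have : b ^+ 2 / (g + 1) ^+ 2 = 0.
  apply/le_anti; rewrite H2 andbT.
  have gg : g - 2 * (g + 1) < 0 by lra.
  by move: H; rewrite nmulr_lge0.
move=> /eqP; rewrite mulf_eq0 invr_eq0 !expf_eq0 /= (gt_eqF g1) orbF => /eqP.
by [].
Qed.

(** By the differential equation the derivative of the solution is the right-hand
    side along the solution, whose derivatives of order below [p] are bounded by
    [L]. *)
Lemma ode_smooth_path T L d M (K : set 'rV[R]_d) f u0 (u : R -> 'rV[R]_d -> 'rV[R]_M) k :
  0 < T -> ode_assumptions T K f u0 p u -> bounds_ode T K f p u L -> K k ->
  smooth_path p T L (u^~ k).
Proof.
move=> T0 Hode Hb Kk m.
have [_ Hd] := ode_solution Hode Kk.
have Hg := ode_smooth Hode (m := m) Kk.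
set g := fun t => u t k 0 m in Hg *.
have p0 : (0 < p)%N by case/andP: hp => /ltnW.
split.
  apply/subspace_continuousP => t At.
  exact: (diff_quot_in_continuous (T := T) At (Hd t m At)).
move=> a aT.
have Aa : `[0, T]%classic a by rewrite /= in_itv.
have [|q sq Hq] := @taylor_poly R T T0 L p g Hg _ a Aa.
  move=> t At; rewrite -(prednK p0) /deriven_in iterSr.
  have E : {in `[0, T]%classic, derive_in `[0, T]%classic g =1 (fun x => f x (u x k) k 0 m)}.
    move=> x; rewrite inE => Ax; apply: derive_inE => //; exact: Hd.
  have := @eq_deriven_in R T p.-1 _ _ E t.
  rewrite /deriven_in inE => /(_ At) ->.
  by have [_ H] := Hb k m t Kk At; apply: H; rewrite prednK.
by exists q => // x xT; apply: Hq; rewrite /= in_itv.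
Qed.

Lemma exists_small_power (A B : R) : 0 <= A -> 0 < B ->
  exists2 eta : R, 0 < eta & forall h, 0 < h -> h < eta -> A * h ^+ p <= B.
Proof.
move=> A0 B0; have A1 : 0 < A + 1 by rewrite ltr_wpDl.
exists (Num.min 1 (B / (A + 1))); first by rewrite lt_min ltr01 divr_gt0.
move=> h h0; rewrite lt_min ltr_pdivlMr // => /andP[h1 hB].
have p0 : (0 < p)%N by case/andP: hp => /ltnW.
have hp1 : h ^+ p <= h by rewrite -[X in _ <= X]expr1 ler_wiXn2l // ltW.
apply: le_trans (ler_wpM2l A0 hp1) _; nra.
Qed.

End Projections.

(** * The multifidelity error *)

Section Bounds.
Context {R : realType} {d M : nat}.
Variables (p r : nat) (T : R) (K : set 'rV[R]_d) (u : R -> 'rV[R]_d -> 'rV[R]_M).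
Variable ud : forall N : nat, 'I_N.+1 -> 'rV[R]_d -> 'rV[R]_M.
Arguments ud : clear implicits.

Lemma norms_le_U_all N : (U_all p T K u ud r N < +oo)%E -> forall k, K k ->
  normH T (u^~ k) <= fine (U_all p T K u ud r N) /\
  normN p T (fun i => ud N i k) <= fine (U_all p T K u ud r N).
Proof.
move=> Ufin k Kk.
have H1 : ((normH T (u^~ k))%:E <= U_all p T K u ud r N)%E.
  by rewrite /U_all le_max; apply/orP; left; apply: ereal_sup_ubound; exists k.
have H2 : ((normN p T (fun i => ud N i k))%:E <= U_all p T K u ud r N)%E.
  rewrite /U_all le_max; apply/orP; right.
  apply: (@le_trans _ _ (U_level p T K ud N)); apply: ereal_sup_ubound.
    by exists k.
  by exists 1%N; rewrite //= /level subnn expn0 muln1.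
have fin : U_all p T K u ud r N \is a fin_num.
  by rewrite fin_real // Ufin (lt_le_trans _ H1) // ltNyr.
by split; rewrite -lee_fin fineK.
Qed.

End Bounds.

Lemma level_admissible p N r j : (0 < r)%N -> admissible p N -> admissible p (level N r j).
Proof.
move=> r0 /andP[N0 PN]; rewrite /admissible /level muln_gt0 N0 expn_gt0 r0 /=.
by rewrite dvdn_mulr.
Qed.

Lemma step_level_le (R : realType) (T : R) N r j : 0 < T -> (0 < N)%N -> (0 < r)%N ->
  step T (level N r j) <= step T N.
Proof.
move=> T0 N0 r0; rewrite /step ler_pM2l // lef_pV2 ?posrE ?ltr0n //.
  by rewrite ler_nat /level leq_pmulr // expn_gt0 r0.
by rewrite /level muln_gt0 N0 expn_gt0 r0.
Qed.

Lemma grid_point_in (R : realType) (T : R) N i : 0 < T -> (0 < N)%N -> (i <= N)%N ->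
  0 <= i%:R * step T N <= T.
Proof.
move=> T0 N0 iN; have N0' : 0 < N%:R :> R by rewrite ltr0n.
rewrite /step mulr_ge0 ?divr_ge0 ?(ltW T0) //=.
by rewrite mulrA ler_pdivrMr // mulrC ler_pM2l // ler_nat.
Qed.

Unset Implicit Arguments.
Set Strict Implicit.

Theorem theorem3p3 (R : realType) (p : nat) (hp : (2 <= p <= 6)%N)
    (Cint : R -> R -> R) :
  exists c1 c2 : R -> R -> R,
  forall (T L : R) (d M r : nat) (K : set 'rV[R]_d)
    (f : R -> 'rV[R]_M -> 'rV[R]_d -> 'rV[R]_M) (u0 : 'rV[R]_d -> 'rV[R]_M)
    (u : R -> 'rV[R]_d -> 'rV[R]_M)
    (ud : forall N : nat, 'I_N.+1 -> 'rV[R]_d -> 'rV[R]_M),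
  0 < T -> (1 <= M)%N -> (2 <= r)%N -> compact K ->
  ode_assumptions T K f u0 p u ->
  bounds_ode T K f p u L ->
  has_global_order p T K u ud (Cint T L) ->
  (forall N, admissible p N -> (U_all p T K u ud r N < +oo)%E) ->
  forall (n : nat) (kq : 'I_n -> 'rV[R]_d),
  (1 <= n)%N -> injective kq -> (forall q, K (kq q)) ->
  let e := fun q t => u t (kq q) in
  let sigma := sigma_min (gramH T e) in
  0 < sigma ->
  forall w : R -> 'rV[R]_d -> 'rV[R]_M,
  (forall k, K k -> is_orth_proj T e (u^~ k) (w^~ k)) ->
  exists2 hbar : R, 0 < hbar &
  forall N, admissible p N -> step T N < hbar ->
  forall v1 : 'rV[R]_d -> 'rV[R]_n,
  (forall k, K k ->
    is_least_squares p T (fun q (i : 'I_N.+1) => ud N i (kq q))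
      (fun i => ud N i k) (v1 k)) ->
  forall j, (1 <= j)%N ->
  let Nj := level N r j in
  let U := fine (U_all p T K u ud r N) in
  let C1 := c1 T L * (U ^+ 3 * n%:R ^+ 2 / sigma ^+ 2) in
  let C2 := c2 T L * (U ^+ 2 * n%:R / sigma) in
  forall k (m : 'I_M) (i : 'I_Nj.+1), K k ->
    `|w (i%:R * step T Nj) k 0 m - multifid ud kq (v1 k) i 0 m| <=
    C1 * step T N ^+ p + C2 * step T Nj ^+ p.
Proof.
have [C C0 HC] := @inner_error R p hp.
pose D T L := C T L + 5 * `|Cint T L|.
exists (fun T L => L * (3 * D T L)), (fun T L => 2 * `|Cint T L|).
move=> T L d M r K f u0 u ud T0 M0 r2 _ Hode Hb [h0 h00 Hord] HU n kq n0 _ Kkq.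
move=> e sigma s0 w Hw.
have r0 : (0 < r)%N := ltnW r2.
have n0' : 0 < n%:R :> R by rewrite ltr0n.
have tm k : K k -> smooth_path p T L (u^~ k) by move=> Kk; exact: ode_smooth_path T0 Hode Hb Kk.
have cp k : K k -> cont_path T (u^~ k) by move=> /tm t m; case: (t m).
have uL k t m : K k -> 0 <= t <= T -> `|u t k 0 m| <= L.
  by move=> Kk tT; have [] := Hb k m t Kk; rewrite ?in_itv.
have L0' : 0 <= L.
  apply: le_trans (uL (kq (Ordinal n0)) 0 (Ordinal M0) (Kkq _) _); first by [].
  by rewrite lexx ltW.
have GE a b : gramH T e a b = innerH T (u^~ (kq b)) (u^~ (kq a)) by rewrite mxE.
(* sqrt (sigma / n) is a lower bound for U that does not depend on N, which
   makes the threshold on h uniform *)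
have sig_le c : (forall a b, `|gramH T e a b| <= c ^+ 2) -> 0 <= c ->
    Num.sqrt (sigma / n%:R) <= c.
  move=> HG c0; rewrite -(ger0_norm c0) -sqrtr_sqr ler_sqrt ?sqr_ge0 // ler_pdivrMr //.
  by rewrite mulrC; exact: sigma_min_le_entries.
set Uc := Num.sqrt (sigma / n%:R) in sig_le.
have Uc0 : 0 < Uc by rewrite sqrtr_gt0 divr_gt0.
have UcL : Uc <= L.
  apply: sig_le => // a b; rewrite GE; apply: innerH_le_cst => //; try exact: cp.
  by move=> t m tT; rewrite normrM expr2; apply: ler_pM => //; exact: uL.
have L0 : 0 < L by apply: lt_le_trans UcL.
have D0 : 0 <= D T L by rewrite addr_ge0 ?C0 // mulr_ge0.
have kap0 : 0 < quad_scale p T.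
  rewrite exprn_gt0 // divr_gt0 // mulr_gt0 // ltr0n.
  by case/andP: hp => /ltnW.
have [e1 e10 He1] := @exists_small_power R p hp `|Cint T L| Uc (normr_ge0 _) Uc0.
have [e2 e20 He2] := @exists_small_power R p hp ((nc_degree p)%:R ^+ p)
  (quad_scale p T * (Uc / L)) (exprn_ge0 _ (ler0n _ _)) (mulr_gt0 kap0 (divr_gt0 Uc0 L0)).
have nDL : 0 <= n%:R * (D T L * L) by rewrite !mulr_ge0.
have s20 : 0 < sigma / 2 by rewrite divr_gt0.
have [e3 e30 He3] := @exists_small_power R p hp _ _ nDL s20.
exists (Num.min h0 (Num.min e1 (Num.min e2 e3))).
  by rewrite !lt_min h00 e10 e20 e30.
move=> N aN; rewrite !lt_min => /and4P[hh0 hh1 hh2 hh3] v1 Hv1 j j1 Nj U C1 C2.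
have [B0 sN0 TE] := admissible_panels aN T0.
have {}He1 := He1 _ sN0 hh1; have {}He2 := He2 _ sN0 hh2; have {}He3 := He3 _ sN0 hh3.
set h := step T N in sN0 hh0 hh1 hh2 hh3 He1 He2 He3 TE *.
have UN k : K k -> normH T (u^~ k) <= U /\ normN p T (fun i => ud N i k) <= U.
  by move=> Kk; exact: norms_le_U_all (HU N aN) k Kk.
have U0 : 0 <= U.
  by have [+ _] := UN _ (Kkq (Ordinal n0)); apply: le_trans; exact: sqrtr_ge0.
have GU a b : `|gramH T e a b| <= U ^+ 2.
  rewrite GE; apply: innerH_le_norm => //; try exact: cp.
    by have [] := UN _ (Kkq b).
  by have [] := UN _ (Kkq a).
have UcU : Uc <= U by exact: sig_le.
(* U depends on N and may exceed L, while the stencils have to fit in [0, T] *)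
pose mm := Num.min U L.
have mU : mm <= U by rewrite /mm ge_min lexx.
have mL : mm <= L by rewrite /mm ge_min lexx orbT.
have Ucm : Uc <= mm by rewrite /mm le_min UcU UcL.
have m0 : 0 < mm by apply: lt_le_trans Ucm.
pose eps := `|Cint T L| * h ^+ p.
have em : eps <= mm by apply: le_trans He1 Ucm.
have dist k i m : K k -> `|grid_values T N (u^~ k) i 0 m - ud N i k 0 m| <= eps.
  move=> Kk; apply: le_trans (Hord N aN hh0 k m i Kk) _.
  by apply: ler_wpM2r; [rewrite exprn_ge0 // ltW|exact: ler_norm].
have grid i : (i <= N)%N -> 0 <= i%:R * h <= T.
  by case/andP: aN => N0 _; exact: grid_point_in.
have disc k : K k -> innerN p T (fun i => ud N i k) (fun i => ud N i k) <= 4 * mm ^+ 2.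
  move=> Kk; rewrite /mm; case: (leP U L) => UL.
    have [_ kU] := UN k Kk; have := innerN_le_norm hp T0 kU kU.
    move=> /(le_trans (ler_norm _)) /le_trans; apply.
    by have := sqr_ge0 U; lra.
  rewrite innerNE -(@grid_mean_cst R p hp M T N (4 * L ^+ 2) M0 T0 aN).
  apply: grid_mean_le => // i m; rewrite -expr2.
  have ub : `|ud N i k 0 m| <= 2 * L.
    have := dist k i m Kk; have := uL k (i%:R * h) m Kk (grid i (ltn_ord i)).
    rewrite /grid_values -/h => H1 H2.
    have := ler_normB (u (i%:R * h) k 0 m) (u (i%:R * h) k 0 m - ud N i k 0 m).
    by rewrite subKr; lra.
  rewrite -[_ ^+ 2]real_normK ?num_real // (_ : 4 * L ^+ 2 = (2 * L) ^+ 2); last by ring.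
  by rewrite lerXn2r // nnegrE mulr_ge0.
pose delta := D T L * mm * h ^+ p.
have inner k k' : K k -> K k' ->
  `|innerH T (u^~ k) (u^~ k') - innerN p T (fun i => ud N i k) (fun i => ud N i k')| <= delta.
  move=> Kk Kk'.
  have := HC T L M N mm eps (u^~ k) (u^~ k') (fun i => ud N i k) (fun i => ud N i k')
    T0 M0 aN m0 mL em _ (tm k Kk) (tm k' Kk').
  have -> : delta = C T L * mm * h ^+ p + 5 * eps * mm by rewrite /delta /D /eps; ring.
  apply.
  - rewrite exprMn; apply: le_trans He2 _; rewrite ler_wpM2l ?(ltW kap0) //.
    by rewrite ler_pM2r // invr_gt0.
  - by move=> i m; exact: dist.
  - by move=> i m; exact: dist.
  - exact: disc.
  - exact: disc.
move=> k m i Kk.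
have [v Hwv Hv] := orth_proj_normal_equations (cp k Kk) (fun q => cp _ (Kkq q)) (Hw k Kk).
have Hlsq := least_squares_normal_equations hp T0 (Hv1 k Kk).
pose G1 : 'M[R]_n := \matrix_(a, b)
  innerN p T (fun i => ud N i (kq b)) (fun i => ud N i (kq a)).
have [||||||S1 S2] := @normal_equations_perturbation R n (gramH T e) G1 v (v1 k)
   (fun a => innerH T (u^~ k) (e a))
   (fun a => innerN p T (fun i => ud N i k) (fun i => ud N i (kq a)))
   (U ^+ 2) delta n0 s0 Hv.
- by move=> a; rewrite -Hlsq; apply: eq_bigr => q _; rewrite mxE.
- by move=> a b; rewrite !mxE; exact: inner.
- by move=> a; exact: inner.
- move=> a; apply: (innerN_le_norm hp T0).
    by have [] := UN _ Kk.
  by have [] := UN _ (Kkq a).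
- exact: GU.
- apply: le_trans He3; rewrite /delta !mulrA ler_wpM2r ?exprn_ge0 ?(ltW sN0) //.
  by rewrite ler_wpM2l // mulr_ge0.
have aj : admissible p Nj by exact: level_admissible.
have N0 : (0 < N)%N by case/andP: aN.
set t := i%:R * step T Nj.
have tT : 0 <= t <= T by case/andP: aj => Nj0 _; exact: (grid_point_in T0 Nj0 (ltn_ord i)).
have hj0 : 0 < step T Nj by have [] := admissible_panels aj T0.
have hjh : step T Nj < h0 by apply: le_lt_trans hh0; exact: step_level_le.
pose epsj := `|Cint T L| * step T Nj ^+ p.
have epsj0 : 0 <= epsj by rewrite mulr_ge0 // exprn_ge0 // ltW.
have distj q : `|u t (kq q) 0 m - ud Nj i (kq q) 0 m| <= epsj.
  apply: le_trans (Hord Nj aj hjh _ m i (Kkq q)) _.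
  by apply: ler_wpM2r; [rewrite exprn_ge0 // ltW|exact: ler_norm].
have -> : w t k 0 m - multifid ud kq (v1 k) i 0 m =
   \sum_q (v - v1 k) 0 q * u t (kq q) 0 m +
   \sum_q v1 k 0 q * (u t (kq q) 0 m - ud Nj i (kq q) 0 m).
  rewrite Hwv ?in_itv // /multifid !summxE -sumrB -big_split; apply: eq_bigr => q _ /=.
  by rewrite !mxE; ring.
have B1 : `|\sum_q (v - v1 k) 0 q * u t (kq q) 0 m| <= L * \sum_q `|(v - v1 k) 0 q|.
  apply: le_trans (ler_norm_sum _ _ _) _; rewrite mulr_sumr; apply: ler_sum => q _.
  by rewrite normrM mulrC ler_wpM2r // uL.
have B2 : `|\sum_q v1 k 0 q * (u t (kq q) 0 m - ud Nj i (kq q) 0 m)| <=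
    epsj * \sum_q `|v1 k 0 q|.
  apply: le_trans (ler_norm_sum _ _ _) _; rewrite mulr_sumr; apply: ler_sum => q _.
  by rewrite normrM mulrC ler_wpM2r.
apply: le_trans (ler_normD _ _) _; apply: lerD.
  apply: le_trans B1 _; apply: le_trans (ler_wpM2l L0' S2) _.
  have X0 : 0 <= U ^+ 2 * n%:R ^+ 2 / sigma ^+ 2.
    by rewrite divr_ge0 ?mulr_ge0 ?exprn_ge0 // ltW.
  have hp0 : 0 <= h ^+ p by rewrite exprn_ge0 // ltW.
  rewrite /C1 -/h (_ : L * (3 * D T L) * (U ^+ 3 * n%:R ^+ 2 / sigma ^+ 2) * h ^+ p =
    L * (3 * (D T L * U * h ^+ p) * (U ^+ 2 * n%:R ^+ 2 / sigma ^+ 2))); last by ring.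
  rewrite ler_wpM2l // ler_wpM2r // ler_wpM2l // ler_wpM2r // ler_wpM2l //.
apply: le_trans B2 _; apply: le_trans (ler_wpM2l epsj0 S1) _.
by rewrite /C2 /epsj; apply: le_of_eq; ring.
Qed.
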